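(* Let $S$ be a closed, simple, densely defined symmetric operator with equal defect numbers in a Hilbert space $\mathfrak{H}$ which commutes with a non-trivial fundamental symmetry $J$, and let $\{C_\alpha\}_{\alpha\in D}$ be the set of all $C$-symmetries of $S$. Let $(\mathcal{H},\Gamma_0,\Gamma_1)$ be a boundary triplet for $S^*$ such that the formulas $$\mathcal{C}_\alpha\Gamma_0 f=\Gamma_0C_\alpha f,\qquad \mathcal{C}_\alpha\Gamma_1 f=\Gamma_1C_\alpha f,\qquad \forall\alpha\in D,\ \forall f\in\mathcal{D}(S^* )$$ correctly define an operator family $\{\mathcal{C}_\alpha\}_{\alpha\in D}$ in $\mathcal{H}$, let $\mathcal{J}$ be the operator $\mathcal{C}_\alpha$ corresponding to $C_\alpha=J$, and let $M(\cdot)$ be the associated Weyl function. Then a bounded operator $\mathcal{C}$ in $\mathcal{H}$ belongs to the set $\{\mathcal{C}_\alpha\}_{\alpha\in D}$ if and only if $$(i)\ \ \mathcal{C}^2=I;\qquad (ii)\ \ \mathcal{J}\mathcal{C}>0;\qquad (iii)\ \ \mathcal{C}M(\lambda)=M(\lambda)\mathcal{C}\ \text{ for all }\lambda\in\mathbb{C}\setminus\mathbb{R}.$$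
   Context: $\mathfrak{H}$ is a Hilbert space with inner product $(\cdot,\cdot)$. A fundamental symmetry is a bounded operator $J$ with $J=J^*$, $J^2=I$; it is non-trivial if $J\neq\pm I$. Commuting with a bounded operator $C$ means $SC=CS$ (including equality of domains). For bounded $T$, $T>0$ means $T$ is self-adjoint and $(Tx,x)>0$ for all $x\neq0$. $\{C_\alpha\}_{\alpha\in D}$ denotes the set (indexed by a set $D$) of all bounded operators $C$ in $\mathfrak{H}$ with $C^2=I$, $JC>0$ and $SC=CS$. It contains $J$. Each such $C$ also commutes with $S^*$. $S$ is simple if the closed linear span of $\bigcup_{\mu\in\mathbb{C}\setminus\mathbb{R}}\ker(S^*-\mu I)$ is $\mathfrak{H}$. A boundary triplet for $S^*$ is a triplet $(\mathcal{H},\Gamma_0,\Gamma_1)$, where $\mathcal{H}$ is a Hilbert space and $\Gamma_0,\Gamma_1:\mathcal{D}(S^* )\to\mathcal{H}$ are linear, such that $(S^*x,y)-(x,S^*y)=(\Gamma_1x,\Gamma_0y)_{\mathcal{H}}-(\Gamma_0x,\Gamma_1y)_{\mathcal{H}}$ for all $x,y\in\mathcal{D}(S^* )$ and $(\Gamma_0,\Gamma_1):\mathcal{D}(S^* )\to\mathcal{H}\oplus\mathcal{H}$ is surjective. ''Correctly define'' means that for each $\alpha$ there is a single well-defined operator $\mathcal{C}_\alpha$ in $\mathcal{H}$ satisfying both formulas. The Weyl function $M(\cdot)$ of $S$ associated with $(\mathcal{H},\Gamma_0,\Gamma_1)$ is the function with values bounded operators in $\mathcal{H}$ determined by $M(\mu)\Gamma_0f_\mu=\Gamma_1f_\mu$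 for all $f_\mu\in\ker(S^*-\mu I)$, $\mu\in\mathbb{C}\setminus\mathbb{R}$. *)

(* Defs.v *)
From HB Require Import structures.
From mathcomp Require Import all_boot all_order all_algebra.
From mathcomp Require Import all_classical all_reals all_analysis.
From mathcomp Require Import complex.

Set Implicit Arguments.
Unset Strict Implicit.
Unset Printing Implicit Defensive.

Import Order.TTheory GRing.Theory Num.Theory.
Import numFieldNormedType.Exports.

Local Open Scope classical_set_scope.
Local Open Scope ring_scope.

(* [inner] is linear in its first argument and conjugate-linear in its
   second; completeness comes from completeNormedModType. *)
HB.mixin Record NormedModule_isHilbert (R : realType) H
    & CompleteNormedModule R[i] H := {
  inner : {dot H for (@Num.conj R[i])} ;
  normrE_inner : forall x : H, `|x| ^+ 2 = inner x x }.

#[short(type="hilbertType")]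
HB.structure Definition Hilbert (R : realType) :=
  { H of NormedModule_isHilbert R H & CompleteNormedModule R[i] H }.

Arguments inner {R s}.

Declare Scope hilbert_scope.
Notation "⟪ x , y ⟫" := (inner x y)
  (at level 0, x at level 99, y at level 99, format "⟪ x ,  y ⟫") :
  hilbert_scope.
Local Open Scope hilbert_scope.

Section Bounded.
Variable R : realType.

Definition bounded_op (V W : hilbertType R) (T : V -> W) : Prop :=
  linear T /\ bounded_near T (nbhs (0 : V)).

Variable H : hilbertType R.
Implicit Types (T C J : H -> H) (A : set H).

(* For an operator defined on the whole space, T = T^* amounts to this
   identity; such a T is automatically linear, and bounded by the
   Hellinger-Toeplitz theorem. *)
Definition self_adjoint T : Prop := forall x y, ⟪T x, y⟫ = ⟪x, T y⟫.

(* The order of R[i] makes 0 < z imply that z is real. *)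
Definition positive_op T : Prop :=
  self_adjoint T /\ forall x, x != 0 -> 0 < ⟪T x, x⟫.

Definition fundamental_symmetry J : Prop :=
  [/\ bounded_op J, self_adjoint J & J \o J = id].

Definition nontrivial_fundamental_symmetry J : Prop :=
  [/\ fundamental_symmetry J, J <> id & J <> -%R].

Definition linear_span A : set H :=
  [set x | exists n (a : 'I_n -> R[i]) (v : 'I_n -> H),
     (forall i, A (v i)) /\ x = \sum_(i < n) a i *: v i].

Definition closed_span A : set H := closure (linear_span A).

Definition orthonormal_basis (N E : set H) : Prop :=
  [/\ E `<=` N,
      forall e, E e -> ⟪e, e⟫ = 1,
      forall e e', E e -> E e' -> e <> e' -> ⟪e, e'⟫ = 0
    & N `<=` closed_span E].

(* Equality of the possibly infinite Hilbert dimensions, as cardinals. *)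
Definition same_hilbert_dim (N N' : set H) : Prop :=
  exists E E',
    [/\ orthonormal_basis N E, orthonormal_basis N' E' & (E #= E')%card].

End Bounded.

Section Unbounded.
Variables (R : realType) (H : hilbertType R).

(* A partially defined map: the values of [app] outside [dom] are junk. *)
Record operator := Operator { dom : set H ; app :> H -> H }.

Implicit Types S : operator.

Definition linear_on (W : hilbertType R) (D : set H) (f : H -> W) : Prop :=
  forall (a : R[i]) x y, D x -> D y -> f (a *: x + y) = a *: f x + f y.

Definition linear_op S : Prop :=
  [/\ dom S 0,
      forall (a : R[i]) x y, dom S x -> dom S y -> dom S (a *: x + y)
    & linear_on (dom S) S].

Definition densely_defined S : Prop := dense (dom S).

Definition graph S : set (H * H) := [set p | dom S p.1 /\ p.2 = S p.1].

Definition closed_op S : Prop := closed (graph S).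

Definition symmetric_op S : Prop :=
  forall x y, dom S x -> dom S y -> ⟪S x, y⟫ = ⟪x, S y⟫.

(* The vectors z that qualify as S^* y; there is at most one when S is
   densely defined. *)
Definition adjoint_values S (y : H) : set H :=
  [set z | forall x, dom S x -> ⟪S x, y⟫ = ⟪x, z⟫].

Definition adjoint S : operator :=
  {| dom := [set y | adjoint_values S y !=set0] ;
     app := fun y => xget 0 (adjoint_values S y) |}.

Definition eigenspace_op S (mu : R[i]) : set H :=
  [set x | dom S x /\ S x = mu *: x].

(* SC = CS for C defined everywhere: the domains of SC and CS are
   C^-1 (dom S) and dom S. *)
Definition commutes_with S (C : H -> H) : Prop :=
  (forall x, dom S (C x) <-> dom S x) /\
  (forall x, dom S x -> S (C x) = C (S x)).

Definition equal_defect_numbers S : Prop :=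
  same_hilbert_dim (eigenspace_op (adjoint S) 'i)
                   (eigenspace_op (adjoint S) (- 'i)).

Definition simple_op S : Prop :=
  closed_span (\bigcup_(mu in [set mu | mu \isn't Num.real])
                 eigenspace_op (adjoint S) mu) = setT.

Definition C_symmetry S (J C : H -> H) : Prop :=
  [/\ bounded_op C, C \o C = id, positive_op (J \o C) & commutes_with S C].

Variable K : hilbertType R.

(* G0 and G1 are only meaningful on the domain of the adjoint. *)
Definition boundary_triplet S (G0 G1 : H -> K) : Prop :=
  let S' := adjoint S in
  [/\ linear_on (dom S') G0,
      linear_on (dom S') G1,
      forall x y, dom S' x -> dom S' y ->
        ⟪S' x, y⟫ - ⟪x, S' y⟫ = ⟪G1 x, G0 y⟫ - ⟪G0 x, G1 y⟫
    & forall h0 h1, exists x, [/\ dom S' x, G0 x = h0 & G1 x = h1]].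

(* Since (G0, G1) is surjective for a boundary triplet, at most one T is
   the boundary image of C, and it is linear when C is. *)
Definition boundary_image S (G0 G1 : H -> K) (C : H -> H) (T : K -> K) : Prop :=
  forall f, dom (adjoint S) f ->
    T (G0 f) = G0 (C f) /\ T (G1 f) = G1 (C f).

(* The values of M at real points are junk. *)
Definition weyl_function S (G0 G1 : H -> K) (M : R[i] -> K -> K) : Prop :=
  forall mu, mu \isn't Num.real ->
    bounded_op (M mu) /\
    forall f, eigenspace_op (adjoint S) mu f -> M mu (G0 f) = G1 f.

End Unbounded.

(* Main.v *)
(* Both directions transport an operator between H and the boundary space K.

   G0 maps ker (S^* - mu) bijectively onto K for nonreal mu, because the
   restriction of S^* to ker G0 is self-adjoint; let gamma(mu) be the inverse.
   If C commutes with S^* and T is its boundary image, then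
   C gamma(mu) = gamma(mu) T, so T commutes with M(mu) = G1 gamma(mu).

   Conversely, if B = calJ T commutes with M then
   (mu - conj nu) (gamma(mu) h, gamma(nu) g) = (M(mu) h, g) - (h, M(nu) g)
   makes gamma(mu) h |-> gamma(mu) (B h) symmetric on the span of the ranges of
   the gamma(mu), dense since S is simple. A symmetric operator whose powers
   grow at most like b^n on each vector has norm at most b, by log-convexity of
   n |-> |A^n x|; so it extends to a bounded self-adjoint A, and C = J A is the
   required symmetry. It commutes with S^* because it commutes with the
   resolvent of S^* restricted to ker G0, and dom S = ker G0 /\ ker G1.

   Positivity passes from one space to the other without square roots. If
   0 <= B_0 <= 1, the Riesz iteration B_(n+1) = B_n - B_n^2 satisfies
   B_n x -> 0, and (B_n x, x) -> 0 alone forces (B_0 x, x) >= |B_0 x|^2. *)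

From HB Require Import structures.
Require Import Defs.
From mathcomp Require Import all_boot all_order all_algebra.
From mathcomp Require Import all_classical all_reals all_analysis.
From mathcomp Require Import complex.
From mathcomp Require Import ring lra.

Set Implicit Arguments.
Unset Strict Implicit.
Unset Printing Implicit Defensive.

Import Order.TTheory GRing.Theory Num.Theory.
Import numFieldNormedType.Exports.

Local Open Scope classical_set_scope.
Local Open Scope ring_scope.
Local Open Scope hilbert_scope.

Local Notation "x %:C" := (real_complex _ x) (at level 1, format "x %:C").
Local Notation Re := (@complex.Re _).
Local Notation Im := (@complex.Im _).

(** * Real-valued norms and inner products *)

Lemma conjcM (R : realType) (a b : R[i]) : conjc (a * b) = conjc a * conjc b.
Proof. exact: rmorphM. Qed.

Lemma ler_eps (R : realType) (a b : R) :
  (forall e : R, 0 < e -> a <= b + e) -> a <= b.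
Proof. by move=> ab; apply/ler_addgt0Pr. Qed.

Lemma natSinv_small (R : realType) (e : R) : 0 < e ->
  exists N, forall n, (N <= n)%N -> n.+1%:R^-1 < e.
Proof.
move=> e0; have [N _ NP] := near_infty_natSinv_lt (PosNum e0).
by exists N => n /NP.
Qed.

Section RealNorm.
Variable R : realType.

(** The norm of a module over [R[i]] takes values in [R[i]], whose order is only partial. Its real
    part lies in [R], where [lra] and [nra] apply. *)
Definition rnorm (V : normedZmodType R[i]) (x : V) : R := Re `|x|.

Variable V : normedZmodType R[i].
Implicit Types x y : V.

Lemma normE_rnorm x : `|x| = (rnorm x)%:C.
Proof. by rewrite /rnorm RRe_real ?normr_real. Qed.

Lemma rnorm_ge0 x : 0 <= rnorm x.
Proof. by rewrite -lecR -normE_rnorm normr_ge0. Qed.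

Lemma rnorm0 : rnorm (0 : V) = 0.
Proof. by apply: complexI; rewrite -normE_rnorm normr0. Qed.

Lemma rnorm_eq0 x : rnorm x = 0 -> x = 0.
Proof. by move=> x0; apply/normr0_eq0; rewrite normE_rnorm x0. Qed.

Lemma rnormN x : rnorm (- x) = rnorm x.
Proof. by rewrite /rnorm normrN. Qed.

Lemma rnormB x y : rnorm (x - y) = rnorm (y - x).
Proof. by rewrite /rnorm distrC. Qed.

Lemma ler_rnormD x y : rnorm (x + y) <= rnorm x + rnorm y.
Proof. by rewrite -lecR rmorphD /= -!normE_rnorm ler_normD. Qed.

Lemma ler_rnormB x y : rnorm (x - y) <= rnorm x + rnorm y.
Proof. by rewrite -(rnormN y) ler_rnormD. Qed.

Lemma rnorm_small x : (forall e, 0 < e -> rnorm x <= e) -> x = 0.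
Proof.
move=> xe; apply/rnorm_eq0/eqP; rewrite eq_le rnorm_ge0 andbT.
by apply: ler_eps => e /xe; rewrite add0r.
Qed.

End RealNorm.

Lemma rnormM (R : realType) (a b : R[i]) : rnorm (a * b) = rnorm a * rnorm b.
Proof. by apply: complexI; rewrite rmorphM /= -!normE_rnorm normrM. Qed.

Lemma rnorm_real (R : realType) (r : R) : 0 <= r -> rnorm (r%:C : R[i]) = r.
Proof. by move=> r0; rewrite /rnorm ger0_norm // ler0c. Qed.

Lemma rnorm_conjc (R : realType) (a : R[i]) : rnorm (conjc a) = rnorm a.
Proof. by rewrite /rnorm normcJ. Qed.

Lemma conjcM_rnorm (R : realType) (a : R[i]) : conjc a * a = (rnorm a ^+ 2)%:C.
Proof. by rewrite mulrC -sqr_normc normE_rnorm -rmorphXn. Qed.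

Section RealNormModule.
Variables (R : realType) (V : normedModType R[i]).
Implicit Types x y : V.

Lemma rnormZ a x : rnorm (a *: x) = rnorm a * rnorm x.
Proof. by apply: complexI; rewrite rmorphM /= -!normE_rnorm normrZ. Qed.

Lemma nbhs_rnorm x (A : set V) :
  nbhs x A <-> exists2 e : R, 0 < e & forall y, rnorm (x - y) < e -> A y.
Proof.
apply: (iff_trans (nbhs_normP x A)); split=> -[e /= e0 eA].
  exists (Re e); first by move: e0; rewrite ltcE /= => /andP[].
  move=> y xy; apply: eA => /=; rewrite normE_rnorm.
  have -> : e = (Re e)%:C by rewrite RRe_real // ger0_real // ltW.
  by rewrite ltcR.
exists e%:C => /=; first by rewrite ltcR.
by move=> y /=; rewrite normE_rnorm ltcR => /eA.
Qed.

Lemma cvg_rnorm (u : nat -> V) l :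
  (u @ \oo --> l) <->
  forall e : R, 0 < e -> exists N, forall n, (N <= n)%N -> rnorm (l - u n) < e.
Proof.
split=> [ul e e0|ul].
  have /ul[N _ NP] : nbhs l [set y | rnorm (l - y) < e].
    by apply/nbhs_rnorm; exists e.
  by exists N => n /NP.
move=> A /nbhs_rnorm[e e0 eA]; have [N NP] := ul e e0.
by exists N => // n /= /NP /eA.
Qed.

Lemma closure_rnorm (A : set V) x :
  closure A x <-> forall e : R, 0 < e -> exists2 y, A y & rnorm (x - y) < e.
Proof.
split=> [Ax e e0|Ax B /nbhs_rnorm[e e0 eB]].
  have [|y [Ay xy]] := Ax [set y | rnorm (x - y) < e].
    by apply/nbhs_rnorm; exists e.
  by exists y.
by have [y Ay /eB By] := Ax e e0; exists y.
Qed.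

End RealNormModule.

Lemma cauchy_rnorm (R : realType) (V : completeNormedModType R[i]) (u : nat -> V) :
  (forall e : R, 0 < e -> exists N, forall m n, (N <= m)%N -> (N <= n)%N ->
     rnorm (u m - u n) < e) ->
  exists l : V, u @ \oo --> l.
Proof.
move=> uC; suff uK : cauchy (u @ \oo).
  by exists (lim (u @ \oo)); apply: (@cauchy_cvg V _ _ uK).
apply: cauchy_exP => e e0.
have [|N NP] := uC (Re e); first by move: e0; rewrite ltcE /= => /andP[].
exists (u N); exists N => // n /= Nn; rewrite -ball_normE /= normE_rnorm.
have -> : e = (Re e)%:C by rewrite RRe_real // ger0_real // ltW.
by rewrite ltcR NP.
Qed.

Section Inner.
Variables (R : realType) (H : hilbertType R).
Implicit Types x y z : H.

Lemma innerDl x y z : ⟪x + y, z⟫ = ⟪x, z⟫ + ⟪y, z⟫.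
Proof. exact: linearDl. Qed.
Lemma innerDr x y z : ⟪x, y + z⟫ = ⟪x, y⟫ + ⟪x, z⟫.
Proof. exact: linearDr. Qed.
Lemma innerBl x y z : ⟪x - y, z⟫ = ⟪x, z⟫ - ⟪y, z⟫.
Proof. exact: linearBl. Qed.
Lemma innerBr x y z : ⟪x, y - z⟫ = ⟪x, y⟫ - ⟪x, z⟫.
Proof. exact: linearBr. Qed.
Lemma innerZl a x y : ⟪a *: x, y⟫ = a * ⟪x, y⟫.
Proof. exact: linearZl_LR. Qed.
Lemma innerZr a x y : ⟪x, a *: y⟫ = conjc a * ⟪x, y⟫.
Proof. exact: linearZr_LR. Qed.
Lemma inner0l x : ⟪0, x⟫ = 0.
Proof. exact: linear0l. Qed.
Lemma inner0r x : ⟪x, 0⟫ = 0.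
Proof. exact: linear0r. Qed.
Lemma innerC x y : ⟪x, y⟫ = conjc ⟪y, x⟫.
Proof. by rewrite hermC /= expr0 mul1r. Qed.

Lemma inner_rnorm x : ⟪x, x⟫ = (rnorm x ^+ 2)%:C.
Proof. by rewrite -normrE_inner normE_rnorm -rmorphXn. Qed.

Lemma Re_inner_rnorm x : Re ⟪x, x⟫ = rnorm x ^+ 2.
Proof. by rewrite inner_rnorm. Qed.

Lemma Re_innerC x y : Re ⟪x, y⟫ = Re ⟪y, x⟫.
Proof. by rewrite innerC; case: (inner y x). Qed.

Lemma rnormD_sqr x y :
  rnorm (x + y) ^+ 2 = rnorm x ^+ 2 + 2 * Re ⟪x, y⟫ + rnorm y ^+ 2.
Proof.
rewrite -!Re_inner_rnorm innerDl !innerDr !raddfD /= (Re_innerC y x); ring.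
Qed.

Lemma rnormB_sqr x y :
  rnorm (x - y) ^+ 2 = rnorm x ^+ 2 - 2 * Re ⟪x, y⟫ + rnorm y ^+ 2.
Proof.
rewrite -!Re_inner_rnorm innerBl !innerBr !raddfB /= (Re_innerC y x); ring.
Qed.

(** The squared norm of [|y| x - |x| y] is [2 |x| |y| (|x| |y| - Re ⟪x, y⟫)], and it is
    nonnegative. *)
Lemma Re_innerM x y : Re ⟪x, y⟫ <= rnorm x * rnorm y.
Proof.
have [/rnorm_eq0 ->|y0] := eqVneq (rnorm y) 0.
  by rewrite inner0r /= rnorm0 mulr0.
have [/rnorm_eq0 ->|x0] := eqVneq (rnorm x) 0.
  by rewrite inner0l /= rnorm0 mul0r.
have xp : 0 < rnorm x by rewrite lt_neqAle eq_sym x0 rnorm_ge0.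
have yp : 0 < rnorm y by rewrite lt_neqAle eq_sym y0 rnorm_ge0.
have := sqr_ge0 (rnorm ((rnorm y)%:C *: x - (rnorm x)%:C *: y)).
rewrite rnormB_sqr !rnormZ innerZl innerZr.
rewrite !rnorm_real ?rnorm_ge0 // conjc_real mulrA -rmorphM /=.
case: (inner x y) => a b /=; rewrite mul0r subr0.
set p := rnorm x; set q := rnorm y => h.
have : 0 <= 2 * (p * q) * (p * q - a).
  by move: h; congr (_ <= _); rewrite -/p -/q; ring.
by rewrite pmulr_rge0 ?subr_ge0 // !mulr_gt0.
Qed.

(** Multiplying [x] by the conjugate of [z = ⟪x, y⟫] turns the inner product into the real number
    [|z|^2], so the bound on real parts applies. *)
Lemma rnorm_inner x y : rnorm (⟪x, y⟫ : R[i]) <= rnorm x * rnorm y.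
Proof.
have [/rnorm_eq0 ->|z0] := eqVneq (rnorm (⟪x, y⟫ : R[i])) 0.
  by rewrite rnorm0 mulr_ge0 ?rnorm_ge0.
set z := ⟪x, y⟫ in z0 *.
have := Re_innerM (conjc z *: x) y; rewrite innerZl -/z rnormZ.
rewrite conjcM_rnorm rnorm_conjc.
by rewrite /= expr2 -mulrA ler_pM2l // lt_neqAle eq_sym z0 rnorm_ge0.
Qed.

Lemma inner_eq0 x : ⟪x, x⟫ = 0 -> x = 0.
Proof.
rewrite inner_rnorm => /(congr1 Re) /= /eqP.
by rewrite sqrf_eq0 => /eqP /rnorm_eq0.
Qed.

Lemma inner_inj x y : (forall z, ⟪z, x⟫ = ⟪z, y⟫) -> x = y.
Proof.
move=> xy; apply/eqP; rewrite -subr_eq0; apply/eqP/inner_eq0.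
by rewrite innerBr xy subrr.
Qed.

Lemma parallelogram x y :
  rnorm (x + y) ^+ 2 + rnorm (x - y) ^+ 2 = 2 * (rnorm x ^+ 2 + rnorm y ^+ 2).
Proof. by rewrite rnormD_sqr rnormB_sqr; ring. Qed.

End Inner.

(** * Bounded operators, orthogonal projection, extension by density *)

Section LinearMaps.
Variables (R : realType) (V W : lmodType R[i]) (T : V -> W).
Hypothesis T_lin : linear T.

Let TL : {linear V -> W} := HB.pack T (GRing.isLinear.Build _ _ _ _ T T_lin).

Lemma lin0 : T 0 = 0. Proof. exact: (linear0 TL). Qed.
Lemma linD x y : T (x + y) = T x + T y. Proof. exact: (linearD TL). Qed.
Lemma linB x y : T (x - y) = T x - T y. Proof. exact: (linearB TL). Qed.
Lemma linZ a x : T (a *: x) = a *: T x. Proof. exact: (linearZ_LR TL). Qed.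

End LinearMaps.

Section Bounded.
Variable R : realType.

Lemma bounded_opP (V W : hilbertType R) (T : V -> W) :
  bounded_op T <->
  linear T /\ exists2 c : R, 0 <= c & forall x, rnorm (T x) <= c * rnorm x.
Proof.
split=> -[Tl].
  move=> Tb; split=> //.
  pose TL' : {linear V -> W} := HB.pack T (GRing.isLinear.Build _ _ _ _ T Tl).
  have /pinfty_ex_gt0[M M0 TM] := (linear_boundedP TL').1 Tb.
  have ME : M = (Re M)%:C by rewrite RRe_real // ger0_real // ltW.
  exists (Re M) => [|x]; first by rewrite -lecR -ME ltW.
  by have := TM x; rewrite !normE_rnorm ME -rmorphM lecR.
case=> c c0 Tc; split=> //.
pose TL' : {linear V -> W} := HB.pack T (GRing.isLinear.Build _ _ _ _ T Tl).
apply/(linear_boundedP TL'); exists c%:C; split.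
  by rewrite ger0_real // ler0c.
move=> M cM x; apply: le_trans (_ : c%:C * `|x| <= _).
  by rewrite !normE_rnorm -rmorphM lecR Tc.
by rewrite ler_wpM2r // ltW.
Qed.

Variable H : hilbertType R.

Lemma dense_eq0 (W : normedModType R[i]) (f : H -> W) (c : R) (P : set H) :
    (forall x y, rnorm (f x - f y) <= c * rnorm (x - y)) ->
    (forall x e, 0 < e -> exists2 x', P x' & rnorm (x - x') < e) ->
  (forall x, P x -> f x = 0) -> forall x, f x = 0.
Proof.
move=> fc Pd fP x; apply: rnorm_small => e e0.
have c0 : 0 < `|c| + 1 by rewrite ltr_wpDl.
have [|x' Px' xx'] := Pd x (e / (`|c| + 1)); first exact: divr_gt0.
have := fc x x'; rewrite (fP x') // subr0 => /le_trans; apply.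
apply: (@le_trans _ _ ((`|c| + 1) * rnorm (x - x'))).
  by rewrite ler_wpM2r ?rnorm_ge0 // (le_trans (ler_norm c)) // lerDl.
by rewrite mulrC -ler_pdivlMr // ltW.
Qed.

(** Projection theorem: a minimizing sequence for the distance from [y] to [L] is Cauchy by the
    parallelogram law, and its limit [p] makes [y - p] orthogonal to [L]. The last hypothesis then
    makes [y - p] orthogonal to itself. *)
Lemma orth_subspace_closed (L : set H) (y : H) :
    L 0 -> (forall a u v, L u -> L v -> L (a *: u + v)) ->
    (forall x, (forall e, 0 < e -> exists2 u, L u & rnorm (x - u) < e) -> L x) ->
    (forall z, (forall u, L u -> ⟪u, z⟫ = 0) -> ⟪y, z⟫ = 0) ->
  L y.
Proof.
move=> L0 Llin Lcl yL.
pose D := [set rnorm (y - u) | u in L]; pose d := inf D.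
have D0 : has_lbound D by exists 0 => _ [u _ <-]; exact: rnorm_ge0.
have D1 : has_inf D by split=> //; exists (rnorm (y - 0)), 0.
have dD u : L u -> d <= rnorm (y - u) by move=> Lu; apply: ge_inf => //; exists u.
have d0 : 0 <= d by apply: lb_le_inf; [case: D1|move=> _ [u _ <-]; exact: rnorm_ge0].
have approx (n : nat) : exists u, L u /\ rnorm (y - u) < d + n.+1%:R^-1.
  have [//|_ [u Lu <-] yu] := inf_adherent (_ : 0 < n.+1%:R^-1) D1.
  by exists u.
have /choice[u uP] := approx.
have LD v w : L v -> L w -> L (v + w).
  by move=> Lv Lw; rewrite -[v]scale1r; exact: Llin.
have LZ a v : L v -> L (a *: v) by move=> Lv; rewrite -[_ *: _]addr0; exact: Llin.
have [p up] : exists p : H, u @ \oo --> p.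
  apply: cauchy_rnorm => e e0.
  (* If [s <= 1] and [s < q], then [(d + s)^2 < d^2 + q (2 d + 1)]. As the midpoint of [u m] and
     [u n] is at distance at least [d] from [y], the parallelogram law gives
     [|u m - u n|^2 < 4 q (2 d + 1) = e^2]. *)
  pose q := e ^+ 2 / (4 * (2 * d + 1)).
  have dp : 0 < 4 * (2 * d + 1) by rewrite mulr_gt0 // ltr_wpDl // mulr_ge0.
  have q0 : 0 < q by rewrite divr_gt0 // exprn_gt0.
  have [N Nq] := natSinv_small q0.
  exists N => m n Nm Nn.
  have [Lm um] := uP m; have [Ln un] := uP n.
  have qm : m.+1%:R^-1 < q := Nq _ Nm.
  have qn : n.+1%:R^-1 < q := Nq _ Nn.
  have i1 k : k.+1%:R^-1 <= 1 :> R by rewrite invf_le1 // ler1n.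
  have h (k : nat) : rnorm (y - u k) < d + k.+1%:R^-1 -> k.+1%:R^-1 < q ->
      rnorm (y - u k) ^+ 2 < d ^+ 2 + q * (2 * d + 1).
    move=> yk kq; have := i1 k; have : 0 <= k.+1%:R^-1 :> R by rewrite invr_ge0.
    have := rnorm_ge0 (y - u k); move: yk kq.
    set t := rnorm _; set s : R := _^-1 => ts sq t0 s0 s1.
    apply: (@lt_le_trans _ _ ((d + s) ^+ 2)); first by rewrite ltrXn2r ?nnegrE ?addr_ge0.
    nra.
  have par := parallelogram (y - u m) (y - u n).
  have e1 : y - u m - (y - u n) = u n - u m by rewrite opprB addrC addrA subrK.
  have e2 : y - u m + (y - u n) = 2%:R *: (y - 2%:R^-1 *: (u m + u n)).
    rewrite scalerBr scalerA mulfV ?pnatr_eq0 // scale1r.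
    by rewrite scaler_nat mulr2n addrACA opprD.
  have dmn : d <= rnorm (y - 2%:R^-1 *: (u m + u n)) by apply/dD/LZ/LD.
  have n2 : rnorm (2%:R : R[i]) = 2 by rewrite /rnorm normr_nat raddfMn.
  move: par; rewrite e1 e2 rnormZ n2 (rnormB (u n)).
  have := h m um qm; have := h n un qn.
  have qE : q * (4 * (2 * d + 1)) = e ^+ 2 by rewrite divfK // gt_eqF.
  move: (rnorm_ge0 (u m - u n)) dmn qE.
  set a := rnorm (u m - u n); set b := rnorm (y - _ *: _).
  set f := rnorm (y - u m) ^+ 2; set g := rnorm (y - u n) ^+ 2.
  move=> a0 db qE hn hm hh; rewrite -(@ltr_pXn2r _ 2) ?nnegrE // ?(ltW e0) //.
  have db2 : d ^+ 2 <= b ^+ 2 by rewrite ler_pXn2r ?nnegrE // (le_trans d0).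
  move: hh; rewrite exprMn; lra.
have {}up := (cvg_rnorm u p).1 up.
have Lp : L p.
  by apply: Lcl => e /up[N /(_ N (leqnn _)) pN]; exists (u N) => //; case: (uP N).
have pd : rnorm (y - p) <= d.
  apply: ler_eps => e e0; have e20 : 0 < e / 2 by rewrite divr_gt0.
  have [N pN] := up _ e20.
  have [N' Nq] := natSinv_small e20.
  pose n := maxn N N'; have pn := pN n (leq_maxl _ _).
  have ne : n.+1%:R^-1 < e / 2 := Nq n (leq_maxr _ _).
  have [_ un] := uP n; have := ler_rnormB (y - u n) (p - u n).
  rewrite opprB addrA subrK; move: pn ne un.
  set a := rnorm (y - p); set b := rnorm (y - u n); set c := rnorm (p - u n).
  by set r : R := n.+1%:R^-1; lra.
suff w0 v : L v -> ⟪v, y - p⟫ = 0.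
  suff /inner_eq0/eqP : ⟪y - p, y - p⟫ = 0 by rewrite subr_eq0 => /eqP ->.
  by rewrite {1}innerBl (w0 p) // yL // subrr.
move=> Lv; set w := y - p in pd *.
pose z := ⟪w, v⟫; suff z0 : rnorm z = 0.
  by rewrite innerC -/z (rnorm_eq0 z0) conjc0.
(* Comparing [p] with [p + t z v] gives [2 t |z|^2 <= t^2 |z|^2 |v|^2], and [t |v|^2 <= 1] forces
   [z = 0]. The added 1 covers [v = 0]. *)
pose t := (rnorm v ^+ 2 + 1)^-1.
have v0 : 0 < rnorm v ^+ 2 + 1 by rewrite ltr_wpDl // sqr_ge0.
have t0 : 0 < t by rewrite invr_gt0.
have tv : t * rnorm v ^+ 2 <= 1.
  by rewrite mulrC ler_pdivrMr // mul1r lerDl.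
have := dD _ (LD _ _ Lp (LZ (t%:C * z) _ Lv)); rewrite opprD addrA -/w.
move/(le_trans pd); rewrite -/w -(@ler_pXn2r _ 2) ?nnegrE ?rnorm_ge0 //.
rewrite (rnormB_sqr w) innerZr -/z conjcM conjc_real -mulrA conjcM_rnorm.
rewrite -rmorphM /= rnormZ rnormM rnorm_real ?(ltW t0) //.
move=> hh; apply/eqP; rewrite -sqrf_eq0 eq_le sqr_ge0 andbT.
have : 0 <= rnorm z ^+ 2 by exact: sqr_ge0.
move: hh tv; rewrite !exprMn; set a := rnorm z ^+ 2; set b := rnorm v ^+ 2.
move=> hh tb a0; have : t * a * (t * b) <= t * a * 1.
  by rewrite ler_wpM2l // mulr_ge0 // ltW.
by rewrite -(pmulr_rle0 a t0); lra.
Qed.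

(** The map is given by its graph [G], so it need not be known to be single-valued beforehand. In
    the closure [Gb] of [G], the bound gives uniqueness of values, and completeness of [W] with
    density of the domain gives existence. *)
Lemma extend_bounded (W : hilbertType R) (G : H -> W -> Prop) (c : R) :
    0 <= c ->
    (forall a x y x' y', G x y -> G x' y' -> G (a *: x + x') (a *: y + y')) ->
    (forall x y, G x y -> rnorm y <= c * rnorm x) ->
    (forall x e, 0 < e -> exists2 x', (exists y, G x' y) & rnorm (x - x') < e) ->
  exists A : H -> W, [/\ linear A, forall x, rnorm (A x) <= c * rnorm x
                       & forall x y, G x y -> A x = y].
Proof.
move=> c0 Glin Gc Gd.
pose Gb x y := forall e, 0 < e ->
  exists x' y', [/\ G x' y', rnorm (x - x') < e & rnorm (y - y') < e].
have GGb x y : G x y -> Gb x y.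
  by move=> Gxy e e0; exists x, y; rewrite !subrr !rnorm0.
have Gblin a x y x' y' : Gb x y -> Gb x' y' -> Gb (a *: x + x') (a *: y + y').
  move=> Gxy Gxy' e e0; pose d := e / (rnorm a + 1).
  have a1 : 0 < rnorm a + 1 by rewrite ltr_wpDl // rnorm_ge0.
  have d0 : 0 < d by rewrite divr_gt0.
  have de : rnorm a * d + d = e.
    by rewrite -[X in _ + X]mul1r -mulrDl mulrC divfK // gt_eqF.
  have [u [v [Guv xu yv]]] := Gxy d d0; have [u' [v' [Guv' xu' yv']]] := Gxy' d d0.
  exists (a *: u + u'), (a *: v + v'); split; first exact: Glin.
    rewrite opprD addrACA -scalerBr (le_lt_trans (ler_rnormD _ _)) // rnormZ.
    by rewrite -de ler_ltD // ler_wpM2l ?rnorm_ge0 // ltW.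
  rewrite opprD addrACA -scalerBr (le_lt_trans (ler_rnormD _ _)) // rnormZ.
  by rewrite -de ler_ltD // ler_wpM2l ?rnorm_ge0 // ltW.
have Gbc x y : Gb x y -> rnorm y <= c * rnorm x.
  move=> Gxy; apply: ler_eps => e e0; pose d := e / (c + 1).
  have c1 : 0 < c + 1 by rewrite ltr_wpDl.
  have d0 : 0 < d by rewrite divr_gt0.
  have de : c * d + d = e by rewrite -[X in _ + X]mul1r -mulrDl mulrC divfK // gt_eqF.
  have [u [v [/Gc vu xu yv]]] := Gxy d d0.
  have := ler_rnormD (y - v) v; have := ler_rnormB x (x - u).
  rewrite subrK opprB addrC subrK; nra.
have Gbt x : exists y, Gb x y.
  have /choice[f fP] (n : nat) : exists p : H * W,
      G p.1 p.2 /\ rnorm (x - p.1) < n.+1%:R^-1.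
    by have [//|x' [y Gxy] xx'] := Gd x n.+1%:R^-1; exists (x', y).
  have Gf m n : rnorm ((f m).2 - (f n).2) <= c * rnorm ((f m).1 - (f n).1).
    have [Gm _] := fP m; have [Gn _] := fP n.
    by have /Gc := Glin (-1) _ _ _ _ Gn Gm; rewrite !scaleN1r ![- _ + _]addrC.
  have near0 e : 0 < e -> exists N, forall n, (N <= n)%N -> rnorm (x - (f n).1) < e.
    move=> e0.
    have [N Nq] := natSinv_small e0.
    by exists N => n /Nq; apply: lt_trans; case: (fP n).
  have [y fy] : exists y : W, (fun n => (f n).2) @ \oo --> y.
    apply: cauchy_rnorm => e e0; pose d := e / (2 * (c + 1)).
    have c1 : 0 < 2 * (c + 1) by rewrite mulr_gt0 // ltr_wpDl.
    have d0 : 0 < d by rewrite divr_gt0.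
    have de : d * (2 * (c + 1)) = e by rewrite divfK // gt_eqF.
    have [N NP] := near0 d d0; exists N => m n /NP mx /NP nx.
    apply: le_lt_trans (Gf m n) _.
    have := ler_rnormB (x - (f n).1) (x - (f m).1).
    rewrite opprB addrC addrA subrK; nra.
  exists y => e e0; have [N1 N1P] := near0 e e0.
  have [N2 N2P] := (cvg_rnorm _ _).1 fy e e0.
  pose n := maxn N1 N2; exists (f n).1, (f n).2; split; first by case: (fP n).
    exact: N1P (leq_maxl _ _).
  exact: N2P (leq_maxr _ _).
have [A AP] := choice Gbt.
have Gbu x y y' : Gb x y -> Gb x y' -> y = y'.
  move=> xy xy'; have /Gbc := Gblin (-1) _ _ _ _ xy' xy.
  rewrite !scaleN1r addNr rnorm0 mulr0 => h; apply/eqP; rewrite -subr_eq0 addrC.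
  by apply/eqP/rnorm_eq0/eqP; rewrite eq_le h rnorm_ge0.
exists A; split=> [a x y|x|x y /GGb xy]; last exact: Gbu xy.
  exact: Gbu (Gblin _ _ _ _ _ _ _).
exact: Gbc.
Qed.

End Bounded.

Lemma subBB (V : zmodType) (a b c : V) : a - b - (a - c) = c - b.
Proof. by rewrite opprB addrC addrA subrK. Qed.

(** * Symmetric operators, adjoints and boundary triplets *)

Lemma ler_Im_rnorm (R : realType) (z : R[i]) : `|Im z| <= rnorm z.
Proof.
rewrite /rnorm normc_def /= -sqrtr_sqr.
by rewrite ler_sqrt ?addr_ge0 ?sqr_ge0 // lerDr sqr_ge0.
Qed.

Lemma lerN_Re_rnorm (R : realType) (z : R[i]) : - Re z <= rnorm z.
Proof.
rewrite (le_trans (ler_norm _)) // normrN -lecR -normE_rnorm.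
exact: normc_ge_Re.
Qed.

Lemma nonreal_Im (R : realType) (z : R[i]) : (z \isn't Num.real) = (Im z != 0).
Proof. by case: z => a b; rewrite /= complex_real. Qed.

Lemma nonreal_conjc (R : realType) (z : R[i]) :
  (conjc z \isn't Num.real) = (z \isn't Num.real).
Proof. by rewrite !nonreal_Im; case: z => a b /=; rewrite oppr_eq0. Qed.

Section Operators.
Variables (R : realType) (H : hilbertType R).
Implicit Types S : operator H.

Lemma closed_op_approx S : closed_op S ->
  forall x w, (forall e : R, 0 < e ->
      exists u, [/\ dom S u, rnorm (x - u) < e & rnorm (w - S u) < e]) ->
    dom S x /\ S x = w.
Proof.
move=> Scl x w app; suff : graph S (x, w) by case=> /= ? ->.
have /closure_id -> := Scl; move=> B.
move=> [[B1 B2] /= [/nbhs_rnorm[e1 e10 h1] /nbhs_rnorm[e2 e20 h2]] sB].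
have e0 : 0 < Num.min e1 e2 by rewrite lt_min e10.
have [u [Su xu wu]] := app _ e0; exists (u, S u); split=> //.
apply: sB; split=> /=.
  by apply: h1; apply: lt_le_trans xu _; rewrite ge_min lexx.
by apply: h2; apply: lt_le_trans wu _; rewrite ge_min lexx orbT.
Qed.

(** [⟪S x, x⟫] is real, so the imaginary part of [⟪S x - mu x, x⟫] is [- Im mu |x|^2];
    Cauchy-Schwarz concludes. *)
Lemma symmetric_lower S (mu : R[i]) x : symmetric_op S -> dom S x ->
  `|Im mu| * rnorm x <= rnorm (S x - mu *: x).
Proof.
move=> Ssym Sx; have [->|x0] := eqVneq (rnorm x) 0; first by rewrite mulr0 rnorm_ge0.
have xp : 0 < rnorm x by rewrite lt_neqAle eq_sym x0 rnorm_ge0.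
suff : `|Im mu| * rnorm x * rnorm x <= rnorm (S x - mu *: x) * rnorm x.
  by rewrite ler_pM2r.
apply: le_trans (rnorm_inner _ _).
apply: le_trans (ler_Im_rnorm _); rewrite innerBl innerZl inner_rnorm.
have : Im ⟪S x, x⟫ = 0.
  have := Ssym x x Sx Sx; rewrite [in RHS]innerC.
  by case: (inner (S x) x) => a b [] /= h; lra.
rewrite raddfB /= => ->; case: mu => a b /=.
by rewrite mulr0 !add0r normrN normrM -mulrA -expr2 (ger0_norm (sqr_ge0 _)).
Qed.

(** The lower bound on [S - mu] makes its range closed, hence equal to its double orthogonal
    complement. Closedness is assumed in approximation form so that the lemma also serves the
    restriction of [S^*] to [ker G0], where it follows from self-adjointness. *)
Lemma range_closed S (mu : R[i]) (w : H) : linear_op S -> symmetric_op S ->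
    (forall x w, (forall e : R, 0 < e ->
        exists u, [/\ dom S u, rnorm (x - u) < e & rnorm (w - S u) < e]) ->
      dom S x /\ S x = w) ->
    mu \isn't Num.real ->
    (forall z, (forall x, dom S x -> ⟪S x - mu *: x, z⟫ = 0) -> ⟪w, z⟫ = 0) ->
  exists2 x, dom S x & S x - mu *: x = w.
Proof.
move=> [S0 Sdom Slin] Ssym Scl; rewrite nonreal_Im => mu0 wz.
have mup : 0 < `|Im mu| by rewrite normr_gt0.
pose L := [set S x - mu *: x | x in dom S].
have SB x y : dom S x -> dom S y -> dom S (x - y) /\ S (x - y) = S x - S y.
  move=> Sx Sy; rewrite [x - y]addrC -scaleN1r; split; first exact: Sdom.
  by rewrite Slin // scaleN1r addrC.
have SL0 : S 0 = 0 by have [_] := SB 0 0 S0 S0; rewrite !subrr.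
suff [x Sx xw] : L w by exists x.
apply: orth_subspace_closed.
- by exists 0 => //; rewrite SL0 scaler0 subrr.
- move=> a _ _ [x Sx <-] [y Sy <-]; exists (a *: x + y); first exact: Sdom.
  by rewrite Slin // scalerBr scalerDr !scalerA (mulrC a) opprD addrACA.
- move=> v Lv.
  have /choice[u uP] (n : nat) : exists u,
      dom S u /\ rnorm (v - (S u - mu *: u)) < n.+1%:R^-1.
    by have [//|_ [u Su <-] vu] := Lv n.+1%:R^-1; exists u.
  pose f n := S (u n) - mu *: u n.
  have fv e : 0 < e -> exists N, forall n, (N <= n)%N -> rnorm (v - f n) < e.
    move=> e0.
    have [N Nq] := natSinv_small e0.
    by exists N => n /Nq; apply: lt_trans; case: (uP n).
  have [x ux] : exists x : H, u @ \oo --> x.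
    apply: cauchy_rnorm => e e0.
    have [N NP] := fv (`|Im mu| * e / 2) (divr_gt0 (mulr_gt0 mup e0) (ltr0Sn _ _)).
    exists N => m n /NP mv /NP nv; have [[Sm _] [Sn _]] := (uP m, uP n).
    have [Smn SmnE] := SB _ _ Sm Sn; rewrite -(ltr_pM2l mup).
    apply: le_lt_trans (symmetric_lower _ Ssym Smn) _; rewrite SmnE.
    have -> : S (u m) - S (u n) - mu *: (u m - u n) = v - f n - (v - f m).
      rewrite subBB /f scalerBr.
      by rewrite !opprD !opprK addrACA.
    apply: le_lt_trans (ler_rnormB _ _) _; rewrite [ltRHS]splitr.
    by apply: ltrD.
  have {}ux := (cvg_rnorm u x).1 ux.
  have [|Sx Sxv] := Scl x (v + mu *: x).
    move=> e e0; pose d := e / (rnorm mu + 1).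
    have m1 : 0 < rnorm mu + 1 by rewrite ltr_wpDl // rnorm_ge0.
    have d0 : 0 < d by rewrite divr_gt0.
    have de : d + rnorm mu * d = e.
      by rewrite addrC -[X in _ + X]mul1r -mulrDl mulrC divfK // gt_eqF.
    have [N1 N1P] := ux d d0; have [N2 N2P] := fv d d0.
    pose n := maxn N1 N2; exists (u n); split; first by case: (uP n).
      apply: lt_le_trans (N1P _ (leq_maxl _ _)) _.
      by rewrite -de lerDl mulr_ge0 ?rnorm_ge0 // ltW.
    have -> : v + mu *: x - S (u n) = (v - f n) + mu *: (x - u n).
      rewrite /f scalerBr opprB -!addrA; congr (_ + _).
      by rewrite [RHS]addrC -[RHS]addrA subrK addrC.
    apply: le_lt_trans (ler_rnormD _ _) _; rewrite rnormZ -de ltr_leD //.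
      exact: N2P (leq_maxr _ _).
    by rewrite ler_wpM2l ?rnorm_ge0 // ltW // N1P // leq_maxl.
  by exists x => //; rewrite Sxv addrK.
- by move=> z Lz; apply: wz => x Sx; apply: Lz; exists x.
Qed.

End Operators.

Section LinearOn.
Variables (R : realType) (H W : hilbertType R) (D : set H) (f : H -> W).
Hypotheses (D0 : D 0) (Dlin : forall (a : R[i]) x y, D x -> D y -> D (a *: x + y)).

Lemma subspaceD x y : D x -> D y -> D (x + y).
Proof. by move=> Dx Dy; rewrite -[x]scale1r; exact: Dlin. Qed.

Lemma subspaceZ a x : D x -> D (a *: x).
Proof. by move=> Dx; rewrite -[_ *: _]addr0; exact: Dlin. Qed.

Lemma subspaceB x y : D x -> D y -> D (x - y).
Proof. by move=> Dx Dy; rewrite addrC -scaleN1r; exact: Dlin. Qed.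

Hypothesis f_lin : linear_on D f.

Lemma linear_on0 : f 0 = 0.
Proof.
have := f_lin (-1) D0 D0; rewrite scaler0 addr0 scaleN1r => {1}->.
exact: addNr.
Qed.

Lemma linear_onD x y : D x -> D y -> f (x + y) = f x + f y.
Proof. by move=> Dx Dy; rewrite -{1}[x]scale1r f_lin // scale1r. Qed.

Lemma linear_onZ a x : D x -> f (a *: x) = a *: f x.
Proof. by move=> Dx; rewrite -{1}[a *: x]addr0 f_lin // linear_on0 addr0. Qed.

Lemma linear_onB x y : D x -> D y -> f (x - y) = f x - f y.
Proof. by move=> Dx Dy; rewrite [x - y]addrC -scaleN1r f_lin // scaleN1r addrC. Qed.

End LinearOn.

Section Dense.
Variables (R : realType) (H : hilbertType R).

Lemma dense_approx (A : set H) : dense A ->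
  forall x (e : R), 0 < e -> exists2 y, A y & rnorm (x - y) < e.
Proof.
move=> Ad x e e0; pose B := [set y | rnorm (x - y) < e].
have Bx : nbhs x B by apply/nbhs_rnorm; exists e.
have [||y [/interior_subset By Ay]] := Ad B°; last by exists y.
  by exists x.
exact: open_interior.
Qed.

Lemma dense_orth (A : set H) (z : H) :
    (forall x e, 0 < e -> exists2 y, A y & rnorm (x - y) < e) ->
  (forall x, A x -> ⟪x, z⟫ = 0) -> z = 0.
Proof.
move=> Ad Az; apply: inner_eq0.
apply: (@dense_eq0 _ _ R[i]^o (fun x => ⟪x, z⟫) (rnorm z) A _ Ad Az).
by move=> x y /=; rewrite -innerBl mulrC; exact: rnorm_inner.
Qed.

(** The pairs [(x, w)] satisfying such an identity form a closed set. This is the tool for passing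
    to limits in graphs and in the spectral parameter. *)
Lemma inner_graph_approx (a b x w : H) :
    (forall e : R, 0 < e -> exists x' w',
       [/\ ⟪a, x'⟫ = ⟪b, w'⟫, rnorm (x - x') < e & rnorm (w - w') < e]) ->
  ⟪a, x⟫ = ⟪b, w⟫.
Proof.
move=> app; apply/eqP; rewrite -subr_eq0; apply/eqP/rnorm_small => e e0.
pose d := e / (rnorm a + rnorm b + 1).
have c0 : 0 < rnorm a + rnorm b + 1 by rewrite ltr_wpDl // addr_ge0 ?rnorm_ge0.
have d0 : 0 < d by rewrite divr_gt0.
have de : d * (rnorm a + rnorm b + 1) = e by rewrite divfK // gt_eqF.
have [x' [w' [xw xx' ww']]] := app d d0.
have -> : ⟪a, x⟫ - ⟪b, w⟫ = ⟪a, x - x'⟫ - ⟪b, w - w'⟫.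
  by rewrite !innerBr xw; ring.
apply: le_trans (ler_rnormB _ _) _.
have := rnorm_inner a (x - x'); have := rnorm_inner b (w - w').
have := rnorm_ge0 a; have := rnorm_ge0 b; move: xx' ww' de d0.
set p := rnorm (_ - _); set q := rnorm (w - _).
set s := rnorm (inner _ _); set t := rnorm (inner _ _).
set u := rnorm a; set v := rnorm b.
nra.
Qed.

End Dense.

Section Adjoint.
Variables (R : realType) (H : hilbertType R) (S : operator H).
Hypotheses (S_dense : densely_defined S) (S_symmetric : symmetric_op S).

Lemma adjoint_valuesP y z :
  adjoint_values S y z -> dom (adjoint S) y /\ adjoint S y = z.
Proof.
move=> yz; split; first by exists z.
rewrite /=; case: xgetP => [w _ yw|/(_ z)//].
apply/eqP; rewrite -subr_eq0; apply/eqP.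
apply: (dense_orth (dense_approx S_dense)) => x Sx.
by rewrite innerBr -yw // -yz // subrr.
Qed.

Lemma adjointE x y : dom (adjoint S) y -> dom S x -> ⟪S x, y⟫ = ⟪x, adjoint S y⟫.
Proof. by move=> Sy Sx; have /(_ x Sx) := xgetPex 0 Sy. Qed.

Lemma adjoint_extends x : dom S x -> dom (adjoint S) x /\ adjoint S x = S x.
Proof. by move=> Sx; apply: adjoint_valuesP => y Sy; exact: S_symmetric. Qed.

Lemma adjoint_linear : linear_op (adjoint S).
Proof.
have lin a x y : dom (adjoint S) x -> dom (adjoint S) y ->
    adjoint_values S (a *: x + y) (a *: adjoint S x + adjoint S y).
  by move=> Sx Sy u Su; rewrite !innerDr !innerZr !adjointE.
split=> [|a x y Sx Sy|a x y Sx Sy].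
- by exists 0 => x Sx; rewrite !inner0r.
- by case: (adjoint_valuesP (lin a x y Sx Sy)).
- by case: (adjoint_valuesP (lin a x y Sx Sy)).
Qed.

(** For [x] in [dom S], [⟪S x, B y⟫ = ⟪S (Bs x), y⟫ = ⟪Bs x, S^* y⟫ = ⟪x, B (S^* y)⟫]. *)
Lemma adjoint_commutes (B Bs : H -> H) :
    (forall x y, ⟪B x, y⟫ = ⟪x, Bs y⟫) ->
    (forall x, dom S x -> dom S (Bs x) /\ S (Bs x) = Bs (S x)) ->
  forall y, dom (adjoint S) y ->
    dom (adjoint S) (B y) /\ adjoint S (B y) = B (adjoint S y).
Proof.
move=> BBs BsS y Sy; apply: adjoint_valuesP => x Sx.
have adj u v : ⟪u, B v⟫ = ⟪Bs u, v⟫ by rewrite innerC BBs -innerC.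
by have [Sb SbE] := BsS x Sx; rewrite !adj -SbE adjointE.
Qed.

End Adjoint.

Section BoundaryTriplet.
Variables (R : realType) (H K : hilbertType R) (S : operator H).
Hypotheses (S_dense : densely_defined S) (S_symmetric : symmetric_op S).
Variables G0 G1 : H -> K.
Hypothesis G_triplet : boundary_triplet S G0 G1.

Local Notation S' := (adjoint S).

Let S'0 : dom S' 0. Proof. by case: (adjoint_linear S_dense). Qed.
Let S'dom a x y : dom S' x -> dom S' y -> dom S' (a *: x + y).
Proof. by case: (adjoint_linear S_dense) => _ + _; exact. Qed.
Let S'lin : linear_on (dom S') S'.
Proof. by case: (adjoint_linear S_dense). Qed.

Lemma triplet_lin0 : linear_on (dom S') G0. Proof. by case: G_triplet. Qed.
Lemma triplet_lin1 : linear_on (dom S') G1. Proof. by case: G_triplet. Qed.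

Lemma triplet_green x y : dom S' x -> dom S' y ->
  ⟪S' x, y⟫ - ⟪x, S' y⟫ = ⟪G1 x, G0 y⟫ - ⟪G0 x, G1 y⟫.
Proof. by case: G_triplet => _ _ + _; exact. Qed.

Lemma triplet_surj h0 h1 : exists x, [/\ dom S' x, G0 x = h0 & G1 x = h1].
Proof. by case: G_triplet => _ _ _; exact. Qed.

(** The left side of Green's identity vanishes for [x] in [dom S] and every [y]; surjectivity then
    allows [y] with boundary values [(0, G0 x)] or [(G1 x, 0)]. *)
Lemma triplet_dom x : dom S x -> G0 x = 0 /\ G1 x = 0.
Proof.
move=> Sx; have [S'x S'xE] := adjoint_extends S_dense S_symmetric Sx.
have g y : dom S' y -> ⟪G1 x, G0 y⟫ = ⟪G0 x, G1 y⟫.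
  move=> S'y; apply/eqP; rewrite -subr_eq0 -triplet_green // S'xE.
  by rewrite adjointE // subrr.
split; apply: inner_eq0.
  by have [y [S'y y0 y1]] := triplet_surj 0 (G0 x); rewrite -{2}y1 -g // y0 inner0r.
by have [y [S'y y0 y1]] := triplet_surj (G1 x) 0; rewrite -{2}y0 g // y1 inner0r.
Qed.

Let A0 : operator H := {| dom := [set x | dom S' x /\ G0 x = 0] ; app := S' |}.

(** Testing on [dom S], which lies in [ker G0], puts [x] in [dom S^*]. Green's identity with a [u]
    such that [G0 u = 0] and [G1 u = G0 x] then gives [|G0 x|^2 = 0]. *)
Lemma triplet_ker0_selfadjoint x w :
    (forall u, dom S' u -> G0 u = 0 -> ⟪S' u, x⟫ = ⟪u, w⟫) ->
  [/\ dom S' x, S' x = w & G0 x = 0].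
Proof.
move=> xw; have [S'x S'xE] : dom S' x /\ S' x = w.
  apply: adjoint_valuesP => // u Su.
  have [S'u S'uE] := adjoint_extends S_dense S_symmetric Su.
  by have [u0 _] := triplet_dom Su; rewrite -S'uE xw.
split=> //; apply: inner_eq0.
have [u [S'u u0 u1]] := triplet_surj 0 (G0 x).
have := triplet_green S'u S'x; rewrite xw // S'xE subrr u0 u1 inner0l subr0.
by move=> <-.
Qed.

Lemma triplet_ker0_symmetric : symmetric_op A0.
Proof.
move=> x y [S'x x0] [S'y y0]; apply/eqP.
by rewrite -subr_eq0 triplet_green // x0 y0 inner0l inner0r subrr.
Qed.

Lemma triplet_ker0_linear : linear_op A0.
Proof.
split=> [|a x y [S'x x0] [S'y y0]|a x y [S'x x0] [S'y y0]].
- by split=> //; exact: (linear_on0 S'0 triplet_lin0).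
- by split; [exact: S'dom|rewrite triplet_lin0 // x0 y0 scaler0 addr0].
- exact: S'lin.
Qed.

Lemma triplet_ker0_lower mu x : dom S' x -> G0 x = 0 ->
  `|Im mu| * rnorm x <= rnorm (S' x - mu *: x).
Proof.
move=> S'x x0.
exact: (@symmetric_lower _ _ A0 mu x triplet_ker0_symmetric (conj S'x x0)).
Qed.

(** A vector orthogonal to the range of [A0 - mu] is an eigenvector of [A0] for [conjc mu] by
    self-adjointness, hence zero by the lower bound. *)
Lemma triplet_ker0_onto mu w : mu \isn't Num.real ->
  exists x, [/\ dom S' x, G0 x = 0 & S' x - mu *: x = w].
Proof.
move=> mu_nr.
have [|z zP|x [S'x x0] xw] := @range_closed _ _ A0 mu w triplet_ker0_linear
  triplet_ker0_symmetric _ mu_nr; last by exists x.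
  move=> x v app; have [u S'u u0|S'x <- x0] := @triplet_ker0_selfadjoint x v; last by [].
  apply: inner_graph_approx => e /app[y [[S'y y0] xy vy]].
  exists y, (S' y); split=> //; exact: triplet_ker0_symmetric.
have [u S'u u0|S'z zE z0] := @triplet_ker0_selfadjoint z (conjc mu *: z).
  apply/eqP; rewrite -subr_eq0 innerZr conjcK -innerZl -innerBl; apply/eqP.
  by apply: zP.
have := triplet_ker0_lower (conjc mu) S'z z0.
rewrite zE subrr rnorm0; have := mu_nr; rewrite -nonreal_conjc nonreal_Im.
rewrite -normr_gt0 => mu0; rewrite pmulr_rle0 // => z_le0.
suff -> : z = 0 by rewrite inner0r.
by apply/rnorm_eq0/eqP; rewrite eq_le z_le0 rnorm_ge0.
Qed.

(** Since both boundary values of [y] vanish, Green's identity makes [(S^* - i) y] orthogonal to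
    [ker (S^* + i)], so it equals [(S - i) x] for some [x] in [dom S]. Then [y - x] lies in [ker G0]
    and is killed by [S^* - i], hence is zero. *)
Lemma triplet_ker_dom y : linear_op S -> closed_op S ->
  dom S' y -> G0 y = 0 -> G1 y = 0 -> dom S y.
Proof.
move=> S_linear S_closed S'y y0 y1.
have ii : 'i%C \isn't @Num.real R[i] by rewrite nonreal_Im /= oner_eq0.
have iiE : conjc (- 'i%C) = 'i%C :> R[i].
  by apply/eqP; rewrite eq_complex /= oppr0 opprK !eqxx.
have [|x Sx xE] := range_closed (w := S' y - 'i%C *: y) S_linear S_symmetric
   (closed_op_approx S_closed) ii.
  move=> z zP; have [S'z zE] : dom S' z /\ S' z = - 'i%C *: z.
    apply: adjoint_valuesP => // x Sx; apply/eqP; rewrite -subr_eq0.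
    rewrite innerZr iiE -innerZl -innerBl.
    by apply/eqP/zP.
  have := triplet_green S'y S'z; rewrite y0 y1 !inner0l subrr zE.
  by rewrite innerBl innerZl innerZr iiE.
have [S'x S'xE] := adjoint_extends S_dense S_symmetric Sx.
have [x0 _] := triplet_dom Sx.
have S'yx : dom S' (y - x) by exact: subspaceB.
suff : y - x = 0 by move/eqP; rewrite subr_eq0 => /eqP ->.
have := @triplet_ker0_lower 'i%C (y - x) S'yx.
rewrite (linear_onB triplet_lin0) // y0 x0 subrr => /(_ erefl).
rewrite (linear_onB S'lin) // S'xE scalerBr.
have -> : S' y - S x - ('i%C *: y - 'i%C *: x) = 0.
  by apply/eqP; rewrite opprD opprK addrACA -xE addrACA subrr addNr addr0.
rewrite rnorm0 /= normr1 mul1r => yx.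
by apply/rnorm_eq0/eqP; rewrite eq_le yx rnorm_ge0.
Qed.

End BoundaryTriplet.

(** * The gamma field *)

Section GammaField.
Variables (R : realType) (H K : hilbertType R) (S : operator H).
Variables G0 G1 : H -> K.

Local Notation S' := (adjoint S).

(* The inverse of G0 on ker (S^* - mu), extended by 0 to real mu so that
   all the identities below hold without side conditions. *)
Definition gamma_field (mu : R[i]) (h : K) : H :=
  xget 0 [set f | [/\ mu \isn't Num.real, eigenspace_op S' mu f & G0 f = h]].

Local Notation gam := gamma_field.

Hypotheses (S_dense : densely_defined S) (S_symmetric : symmetric_op S).
Hypothesis G_triplet : boundary_triplet S G0 G1.

Let S'0 : dom S' 0. Proof. by case: (adjoint_linear S_dense). Qed.
Let S'dom a x y : dom S' x -> dom S' y -> dom S' (a *: x + y).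
Proof. by case: (adjoint_linear S_dense) => _ + _; exact. Qed.
Let S'lin : linear_on (dom S') S'.
Proof. by case: (adjoint_linear S_dense). Qed.
Let G0lin := triplet_lin0 G_triplet.

Lemma gamma_real mu h : mu \is Num.real -> gam mu h = 0.
Proof. by move=> mur; apply: xgetPN => f [] /negP. Qed.

(** Existence: from any [x] with [G0 x = h], subtract the [u] in [ker G0] that solves
    [(S^* - mu) u = (S^* - mu) x]. *)
Lemma gammaP mu h : mu \isn't Num.real ->
  [/\ dom S' (gam mu h), S' (gam mu h) = mu *: gam mu h & G0 (gam mu h) = h].
Proof.
move=> mu_nr; suff ex : exists f,
    [/\ mu \isn't Num.real, eigenspace_op S' mu f & G0 f = h].
  by have [_ [? ?] ?] := xgetPex 0 ex.
have [x [S'x xh _]] := triplet_surj G_triplet h 0.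
have [u [S'u u0 uE]] :=
  triplet_ker0_onto S_dense S_symmetric G_triplet (S' x - mu *: x) mu_nr.
have S'xu : dom S' (x - u) by exact: subspaceB.
exists (x - u); split=> //; last by rewrite (linear_onB G0lin) // u0 xh subr0.
split=> //; rewrite (linear_onB S'lin) // scalerBr.
by rewrite -[S' x](subrK (mu *: x)) -uE addrAC [S' u - _]addrC addrK addrC.
Qed.

Lemma gamma_uniq mu f g : mu \isn't Num.real ->
  eigenspace_op S' mu f -> eigenspace_op S' mu g -> G0 f = G0 g -> f = g.
Proof.
move=> mu_nr [S'f fE] [S'g gE] fg; have S'fg : dom S' (f - g) by exact: subspaceB.
have := triplet_ker0_lower G_triplet mu S'fg.
rewrite (linear_onB G0lin) // fg subrr => /(_ erefl).
rewrite (linear_onB S'lin) // fE gE -scalerBr subrr rnorm0.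
move: mu_nr; rewrite nonreal_Im -normr_gt0 => mu0; rewrite pmulr_rle0 // => h.
by apply/eqP; rewrite -subr_eq0; apply/eqP/rnorm_eq0/eqP; rewrite eq_le h rnorm_ge0.
Qed.

Lemma gamma_eigen mu f : mu \isn't Num.real ->
  eigenspace_op S' mu f -> gam mu (G0 f) = f.
Proof.
move=> mu_nr fE; have [? ? ?] := gammaP (G0 f) mu_nr.
exact: (@gamma_uniq mu).
Qed.

Lemma gamma_linear mu : linear (gam mu).
Proof.
move=> a h g; have [mu_r|mu_nr] := boolP (mu \is Num.real).
  by rewrite !gamma_real // scaler0 addr0.
have [? ? ?] := gammaP (a *: h + g) mu_nr.
have [S'h hE h0] := gammaP h mu_nr; have [S'g gE g0] := gammaP g mu_nr.
apply: (@gamma_uniq mu) => //; last by rewrite G0lin // h0 g0.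
by split; [exact: S'dom|rewrite S'lin // hE gE scalerDr !scalerA mulrC].
Qed.

(** With [A0] the restriction of [S^*] to [ker G0], this is the resolvent identity [gamma(mu) -
    gamma(nu) = (mu - nu) (A0 - mu)^-1 gamma(nu)], written without inverses. *)
Lemma gamma_resolvent mu nu h : mu \isn't Num.real -> nu \isn't Num.real ->
  let u := gam mu h - gam nu h in
  [/\ dom S' u, G0 u = 0 & S' u - mu *: u = (mu - nu) *: gam nu h].
Proof.
move=> mu_nr nu_nr u.
have [S'm mE m0] := gammaP h mu_nr; have [S'n nE n0] := gammaP h nu_nr.
split; first exact: subspaceB.
  by rewrite (linear_onB G0lin) // m0 n0 subrr.
rewrite /u (linear_onB S'lin) // mE nE scalerBr subBB.
by rewrite scalerBl.
Qed.

Lemma gamma_diff mu nu h : mu \isn't Num.real -> nu \isn't Num.real ->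
  `|Im mu| * rnorm (gam mu h - gam nu h) <= rnorm (mu - nu) * rnorm (gam nu h).
Proof.
move=> mu_nr nu_nr; have [S'u u0 uE] := gamma_resolvent h mu_nr nu_nr.
by rewrite -rnormZ -uE; exact: (triplet_ker0_lower G_triplet).
Qed.

Lemma gamma_approx mu h (e : R) : mu \isn't Num.real -> 0 < e ->
  exists2 d, 0 < d & forall nu, nu \isn't Num.real -> rnorm (nu - mu) < d ->
    rnorm (gam nu h - gam mu h) < e.
Proof.
move=> mu_nr e0; have mu0 : 0 < `|Im mu| by move: mu_nr; rewrite nonreal_Im normr_gt0.
pose g := rnorm (gam mu h) + 1.
have g0 : 0 < g by rewrite ltr_wpDl // rnorm_ge0.
(* The first bound keeps [|Im nu|] at least [|Im mu| / 2]; the second then makes the estimate of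
   [gamma_diff] smaller than [e]. *)
pose d := Num.min (`|Im mu| / 2) (e * (`|Im mu| / 2) / g).
have d0 : 0 < d by rewrite lt_min !divr_gt0 ?mulr_gt0 ?divr_gt0.
exists d => // nu nu_nr; rewrite lt_min => /andP[d1 d2].
have nu2 : `|Im mu| / 2 <= `|Im nu|.
  have : `|Im mu| <= `|Im nu| + `|Im (nu - mu)|.
    rewrite -[X in `|X| <= _](subKr (Im nu)) (le_trans (ler_normB _ _)) //.
    by rewrite raddfB.
  have := ler_Im_rnorm (nu - mu).
  by move: d1; set a := `|Im mu|; set b := rnorm _; set c := `|Im (nu - mu)|; lra.
have diff := gamma_diff h nu_nr mu_nr.
rewrite ltNge; apply/negP => et; move: d2; rewrite ltr_pdivlMr // ltNge => /negP; apply.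
have a0 : 0 <= `|Im mu| / 2 by rewrite divr_ge0.
rewrite mulrC; apply: le_trans (ler_pM a0 (ltW e0) nu2 et) _.
by rewrite (le_trans diff) // ler_wpM2l ?rnorm_ge0 // lerDl.
Qed.

Variable M : R[i] -> K -> K.
Hypothesis M_weyl : weyl_function S G0 G1 M.

Lemma weyl_gamma mu h : mu \isn't Num.real -> G1 (gam mu h) = M mu h.
Proof.
move=> mu_nr; have [_ M1] := M_weyl mu_nr; have [? ? h0] := gammaP h mu_nr.
by rewrite -M1 // h0.
Qed.

Lemma gamma_inner mu nu h g : mu \isn't Num.real -> nu \isn't Num.real ->
  (mu - conjc nu) * ⟪gam mu h, gam nu g⟫ = ⟪M mu h, g⟫ - ⟪h, M nu g⟫.
Proof.
move=> mu_nr nu_nr.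
have [S'h hE h0] := gammaP h mu_nr; have [S'g gE g0] := gammaP g nu_nr.
have := triplet_green G_triplet S'h S'g.
by rewrite hE gE innerZl innerZr -mulrBl !weyl_gamma // h0 g0.
Qed.

(** Taking [nu = mu] and [g = h] in [gamma_inner] bounds [2 |Im mu| |gam mu h|^2] by twice the bound
    of [M mu] times [|h|^2]. *)
Lemma gamma_bounded mu :
  exists2 c : R, 0 <= c & forall h, rnorm (gam mu h) <= c * rnorm h.
Proof.
have [mu_r|mu_nr] := boolP (mu \is Num.real).
  by exists 0 => // h; rewrite gamma_real // rnorm0 mul0r.
have [/bounded_opP[_ [m m0 Mm]] _] := M_weyl mu_nr.
have mu0 : 0 < `|Im mu| by move: mu_nr; rewrite nonreal_Im normr_gt0.
have [t t0 tE] : exists2 t, 0 <= t & t * `|Im mu| = m.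
  by exists (m / `|Im mu|); rewrite ?divr_ge0 ?divfK ?gt_eqF // ltW.
(* [t + 1] replaces the square root of [t], since [t <= (t + 1)^2]. *)
exists (t + 1) => [|h]; first by rewrite addr_ge0.
have := congr1 (@rnorm R _) (gamma_inner h h mu_nr mu_nr).
rewrite rnormM inner_rnorm rnorm_real ?sqr_ge0 // => gE.
have le1 : 2 * `|Im mu| <= rnorm (mu - conjc mu).
  apply: le_trans (ler_Im_rnorm _); case: (mu) => a b /=.
  by rewrite opprK -mulr2n normrMn mulr_natl.
have le2 : rnorm (⟪M mu h, h⟫ - ⟪h, M mu h⟫) <= 2 * m * rnorm h ^+ 2.
  apply: le_trans (ler_rnormB _ _) _.
  have := rnorm_inner (M mu h) h; have := rnorm_inner h (M mu h).
  have := Mm h; have := rnorm_ge0 h.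
  set a := rnorm h; set b := rnorm (M mu h); set c := rnorm _; set d := rnorm _; nra.
have gm : `|Im mu| * rnorm (gam mu h) ^+ 2 <= m * rnorm h ^+ 2.
  move: le1 le2; rewrite -gE; have := sqr_ge0 (rnorm (gam mu h)).
  set a := rnorm (gam mu h) ^+ 2; set b := `|Im mu|.
  by set c := rnorm (_ - _); set d := rnorm h ^+ 2; nra.
have gt : rnorm (gam mu h) ^+ 2 <= t * rnorm h ^+ 2.
  by rewrite -(ler_pM2l mu0) (mulrA _ t) (mulrC _ t) tE.
rewrite -(@ler_pXn2r _ 2) ?nnegrE ?mulr_ge0 ?addr_ge0 ?rnorm_ge0 //.
apply: le_trans gt _; rewrite exprMn ler_wpM2r ?sqr_ge0 //.
nra.
Qed.

End GammaField.

(** * The Riesz iteration *)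

Section RieszIteration.
Variables (R : realType) (V : hilbertType R).
Implicit Types (B : V -> V) (x y : V).

Fixpoint riesz_iter B n x : V :=
  if n is n'.+1 then riesz_iter B n' x - riesz_iter B n' (riesz_iter B n' x) else B x.

Lemma riesz_iter_linear B n : linear B -> linear (riesz_iter B n).
Proof.
move=> Bl; elim: n => [//|n IH] a x y /=.
by rewrite !IH scalerBr opprD addrACA.
Qed.

Lemma riesz_iter_sym B n : self_adjoint B -> self_adjoint (riesz_iter B n).
Proof. by move=> Bs; elim: n => [//|n IH] x y /=; rewrite innerBl innerBr !IH. Qed.

Lemma riesz_iter_step B n x : self_adjoint B ->
  Re ⟪riesz_iter B n.+1 x, x⟫ =
    Re ⟪riesz_iter B n x, x⟫ - rnorm (riesz_iter B n x) ^+ 2.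
Proof.
move=> Bs; rewrite /= innerBl raddfB /=; congr (_ - _).
by rewrite (riesz_iter_sym n Bs) Re_inner_rnorm.
Qed.

(* With B_n = riesz_iter B n,
   B_n - B_n^2 = B_n (1 - B_n) B_n + (1 - B_n) B_n (1 - B_n). *)
Lemma riesz_iter_bounds B n : linear B -> self_adjoint B ->
    (forall x, 0 <= Re ⟪B x, x⟫ <= rnorm x ^+ 2) ->
  forall x, 0 <= Re ⟪riesz_iter B n x, x⟫ <= rnorm x ^+ 2.
Proof.
move=> Bl Bs Bp; elim: n => [//|n IH] x; apply/andP; split; last first.
  rewrite riesz_iter_step //; have /andP[_ h] := IH x.
  by rewrite (le_trans _ h) // gerBl sqr_ge0.
set C := riesz_iter B n in IH *; rewrite /= -/C.
have Cl : linear C := riesz_iter_linear n Bl.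
have -> : ⟪C x - C (C x), x⟫ =
    ⟪C x, C x⟫ - ⟪C (C x), C x⟫ + ⟪C (x - C x), x - C x⟫.
  by rewrite (linB Cl) !innerBl !innerBr; ring.
have /andP[_ h1] := IH (C x); have /andP[h2 _] := IH (x - C x).
by rewrite raddfD raddfB /= Re_inner_rnorm; lra.
Qed.

(** By telescoping, the sum of the [|B_k x|^2] over [k < n] is [(B x, x) - (B_n x, x)], at most
    [(B x, x)]. The series converges, so its terms tend to 0. *)
Lemma riesz_iter_cvg0 B : linear B -> self_adjoint B ->
    (forall x, 0 <= Re ⟪B x, x⟫ <= rnorm x ^+ 2) ->
  forall x (e : R), 0 < e ->
    exists N, forall n, (N <= n)%N -> rnorm (riesz_iter B n x) < e.
Proof.
move=> Bl Bs Bp x e e0; pose u n := rnorm (riesz_iter B n x) ^+ 2.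
have uE n : \sum_(k < n) u k = Re ⟪B x, x⟫ - Re ⟪riesz_iter B n x, x⟫.
  elim: n => [|n IH]; first by rewrite big_ord0 subrr.
  by rewrite big_ord_recr /= IH riesz_iter_step // /u; lra.
have u0 n : 0 <= u n by exact: sqr_ge0.
have uc : cvgn (series u).
  apply: nondecreasing_is_cvgn.
    by apply: nondecreasing_series => n _ _; exact: u0.
  exists (Re ⟪B x, x⟫) => _ [n _ <-]; rewrite /series /= big_mkord uE.
  by have /andP[h _] := riesz_iter_bounds n Bl Bs Bp x; lra.
have /cvgr0Pnorm_lt /(_ _ (exprn_gt0 2 e0))[N _ NP] := cvg_series_cvg_0 uc.
exists N => n /NP /=; rewrite ger0_norm // /u ltr_pXn2r ?nnegrE ?rnorm_ge0 //.
exact: ltW.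
Qed.

(** [(B_n x, x)] decreases in [n], and its first step already subtracts [|B x|^2]. The hypothesis
    involves only the form at [x], so it can be verified through iterates on the other space. *)
Lemma riesz_iter_lower B x : self_adjoint B ->
    (forall e : R, 0 < e ->
       exists N, forall n, (N <= n)%N -> rnorm (⟪riesz_iter B n x, x⟫ : R[i]) < e) ->
  rnorm (B x) ^+ 2 <= Re ⟪B x, x⟫.
Proof.
move=> Bs B0; apply: ler_eps => e /B0[N NP].
have mono n : Re ⟪riesz_iter B n.+1 x, x⟫ <= Re ⟪B x, x⟫ - rnorm (B x) ^+ 2.
  elim: n => [|n IH]; first by rewrite riesz_iter_step.
  by rewrite riesz_iter_step // (le_trans _ IH) // gerBl sqr_ge0.
have := mono N; have := NP N.+1 (leqnSn N).
set z := inner _ _ => ze zm.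
have := lerN_Re_rnorm z.
move: ze zm; set a := rnorm z; set b := rnorm (B x) ^+ 2; lra.
Qed.

Definition rescale (k : R) B x : V := (k^-1)%:C *: B x.

Lemma Re_inner_real (r : R) x y : Re ⟪r%:C *: x, y⟫ = r * Re ⟪x, y⟫.
Proof. by rewrite innerZl /=; case: (inner _ _) => s t /=; rewrite mul0r subr0. Qed.

Lemma rescale_linear k B : linear B -> linear (rescale k B).
Proof. by move=> Bl a x y; rewrite /rescale Bl scalerDr !scalerA mulrC. Qed.

Lemma rescale_self_adjoint k B : self_adjoint B -> self_adjoint (rescale k B).
Proof. by move=> Bs x y; rewrite /rescale innerZl innerZr Bs conjc_real. Qed.

Lemma rescale_bounds k B : 0 < k -> (forall x, rnorm (B x) <= k * rnorm x) ->
    (forall x, 0 <= Re ⟪B x, x⟫) ->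
  forall x, 0 <= Re ⟪rescale k B x, x⟫ <= rnorm x ^+ 2.
Proof.
move=> k0 Bk Bp x; rewrite Re_inner_real mulr_ge0 ?invr_ge0 ?(ltW k0) //=.
rewrite ler_pdivrMl // (le_trans (Re_innerM _ _)) //.
by rewrite expr2 mulrA ler_wpM2r ?rnorm_ge0.
Qed.

Lemma rescale_lower k B x : 0 < k ->
    rnorm (rescale k B x) ^+ 2 <= Re ⟪rescale k B x, x⟫ ->
  rnorm (B x) ^+ 2 <= k * Re ⟪B x, x⟫.
Proof.
move=> k0; have ki0 : 0 < k^-1 by rewrite invr_gt0.
rewrite Re_inner_real rnormZ rnorm_real ?(ltW ki0) // exprMn expr2 -mulrA ler_pM2l //.
by rewrite ler_pdivrMl.
Qed.

End RieszIteration.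

(** * Boundary images *)

(** Injectivity makes the left side of the bound nonzero when [x] is; self-adjointness makes the
    form real, as the order of [R[i]] requires. *)
Lemma positive_op_lower (R : realType) (V : hilbertType R) (B : V -> V) (c : R) :
    0 < c -> self_adjoint B -> (forall x, B x = 0 -> x = 0) ->
    (forall x, rnorm (B x) ^+ 2 <= c * Re ⟪B x, x⟫) ->
  positive_op B.
Proof.
move=> c0 Bs B0 Bc; split=> // x x0.
have Bx0 : 0 < rnorm (B x) ^+ 2.
  rewrite exprn_gt0 // lt_neqAle rnorm_ge0 andbT eq_sym.
  by apply: contra_neq x0 => /rnorm_eq0 /B0.
rewrite ltcE /= -(pmulr_rgt0 _ c0) (lt_le_trans Bx0 (Bc x)) andbT.
have := Bs x x; rewrite [in RHS]innerC.
by case: (inner (B x) x) => a b [] /= h; apply/eqP; lra.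
Qed.

Section BoundaryPairs.
Variables (R : realType) (H K : hilbertType R) (S : operator H).
Variables G0 G1 : H -> K.
Hypotheses (S_dense : densely_defined S) (S_symmetric : symmetric_op S).
Hypothesis G_triplet : boundary_triplet S G0 G1.

Local Notation S' := (adjoint S).
Local Notation gam := (gamma_field S G0).

(** [boundary_image] alone does not keep [A x] in [dom S^*]. With the commutation added, pairs are
    stable under composition and linear combination, hence under the Riesz iteration. *)
Definition boundary_pair (A : H -> H) (B : K -> K) : Prop :=
  (forall x, dom S' x -> dom S' (A x) /\ S' (A x) = A (S' x)) /\
  boundary_image S G0 G1 A B.

Let S'0 : dom S' 0. Proof. by case: (adjoint_linear S_dense). Qed.
Let S'dom a x y : dom S' x -> dom S' y -> dom S' (a *: x + y).
Proof. by case: (adjoint_linear S_dense) => _ + _; exact. Qed.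
Let S'lin : linear_on (dom S') S'.
Proof. by case: (adjoint_linear S_dense). Qed.
Let G0lin := triplet_lin0 G_triplet.
Let G1lin := triplet_lin1 G_triplet.

Lemma boundary_pair_linear A B : linear A -> boundary_pair A B -> linear B.
Proof.
move=> Al [AS AB] a h g.
have [x [S'x <- _]] := triplet_surj G_triplet h 0.
have [y [S'y <- _]] := triplet_surj G_triplet g 0.
rewrite -G0lin // (AB _ (S'dom a S'x S'y)).1 Al.
have [[S'Ax _] [S'Ay _]] := (AS x S'x, AS y S'y).
by rewrite G0lin // (AB x S'x).1 (AB y S'y).1.
Qed.

Lemma boundary_pair_comp A B A' B' :
  boundary_pair A B -> boundary_pair A' B' -> boundary_pair (A \o A') (B \o B').
Proof.
move=> [AS AB] [AS' AB']; split=> x S'x; have [S'x' E'] := AS' x S'x.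
  by have [? E] := AS _ S'x'; split=> //; rewrite [LHS]E E'.
have [h0 h1] := AB' x S'x; have [h0' h1'] := AB _ S'x'.
by rewrite /= h0 h1.
Qed.

Lemma boundary_pairB A B A' B' : linear B -> linear B' ->
  boundary_pair A B -> boundary_pair A' B' ->
  boundary_pair (fun x => A x - A' x) (fun h => B h - B' h).
Proof.
move=> Bl Bl' [AS AB] [AS' AB']; split=> x S'x; have [S'x' E'] := AS' x S'x;
  have [S'x1 E1] := AS x S'x.
  by split; [exact: subspaceB|rewrite (linear_onB S'lin) // E1 E'].
have [h0 h1] := AB' x S'x; have [h0' h1'] := AB x S'x.
by rewrite (linear_onB G0lin) // (linear_onB G1lin) // h0 h1 h0' h1'.
Qed.

Lemma boundary_pairZ a A B :
  boundary_pair A B -> boundary_pair (fun x => a *: A x) (fun h => a *: B h).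
Proof.
move=> [AS AB]; split=> x S'x; have [S'x1 E1] := AS x S'x.
  split; first exact: (subspaceZ S'0 S'dom).
  by rewrite (linear_onZ S'0 S'lin) // E1.
have [h0 h1] := AB x S'x.
by rewrite (linear_onZ S'0 G0lin) // (linear_onZ S'0 G1lin) // h0 h1.
Qed.

Lemma boundary_pair_riesz A B n : linear A -> boundary_pair A B ->
  boundary_pair (riesz_iter A n) (riesz_iter B n).
Proof.
move=> Al AB; have Bl := boundary_pair_linear Al AB.
elim: n => [//|n IH]; have Bnl := riesz_iter_linear n Bl.
apply: (boundary_pairB Bnl _ IH (boundary_pair_comp IH IH)).
by move=> a x y; rewrite /comp !Bnl.
Qed.

(** For [x] with boundary values [(0, a)] and [y] with [(b, 0)], Green's identity at [(A x, y)]
    yields [⟪B a, b⟫] and at [(x, A y)] yields [⟪a, B b⟫]; the left sides agree because [A] is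
    symmetric and commutes with [S^*]. *)
Lemma boundary_pair_self_adjoint A B :
  boundary_pair A B -> self_adjoint A -> self_adjoint B.
Proof.
move=> [AS AB] As a b.
have [x [S'x x0 x1]] := triplet_surj G_triplet 0 a.
have [y [S'y y0 y1]] := triplet_surj G_triplet b 0.
have [[S'Ax AxE] [S'Ay AyE]] := (AS x S'x, AS y S'y).
have := triplet_green G_triplet S'Ax S'y; have := triplet_green G_triplet S'x S'Ay.
rewrite -(AB x S'x).1 -(AB x S'x).2 -(AB y S'y).1 -(AB y S'y).2 x0 x1 y0 y1.
rewrite inner0l inner0r !subr0 => <- <-.
by rewrite AxE AyE -!As.
Qed.

Lemma boundary_pair_form A B f y : boundary_pair A B -> dom S' f -> dom S' y ->
  G0 y = 0 -> ⟪B (G0 f), G1 y⟫ = ⟪A f, S' y⟫ - ⟪A (S' f), y⟫.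
Proof.
move=> [AS AB] S'f S'y y0; have [S'Af AfE] := AS f S'f.
have := triplet_green G_triplet S'Af S'y.
by rewrite AfE y0 inner0r sub0r (AB f S'f).1 => /(congr1 -%R); rewrite opprK opprB.
Qed.

(* The quadratic form of B is expressed through A by boundary_pair_form, so
   the Riesz iterates of B tend weakly to 0 because those of A tend
   strongly to 0. *)
Lemma boundary_pair_lower A B : bounded_op A -> self_adjoint A ->
    (forall x, 0 <= Re ⟪A x, x⟫) -> boundary_pair A B ->
  exists2 c : R, 0 < c & forall h, rnorm (B h) ^+ 2 <= c * Re ⟪B h, h⟫.
Proof.
move=> /bounded_opP[Al [k k0 Ak]] As Ap AB.
have [c c0 Ac] : exists2 c, 0 < c & forall x, rnorm (A x) <= c * rnorm x.
  exists (k + 1) => [|x]; first by rewrite ltr_wpDl.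
  by rewrite (le_trans (Ak x)) // ler_wpM2r ?rnorm_ge0 // lerDl.
exists c => // h; set A' := rescale c A; set B' := rescale c B.
have A'l : linear A' := rescale_linear c Al.
have A's : self_adjoint A' := rescale_self_adjoint c As.
have A'p := rescale_bounds c0 Ac Ap.
have AB' : boundary_pair A' B' by exact: boundary_pairZ.
have B's : self_adjoint B' := boundary_pair_self_adjoint AB' A's.
apply: rescale_lower => //; apply: riesz_iter_lower => // e e0.
(* These boundary values turn [⟪B (G0 f), G1 y⟫] into [⟪B h, h⟫] while keeping [y] in [ker G0], and
   likewise for every iterate. *)
have [f [S'f f0 _]] := triplet_surj G_triplet h 0.
have [y [S'y y0 y1]] := triplet_surj G_triplet 0 h.
pose m := rnorm y + rnorm (S' y) + 1.
have m0 : 0 < m by rewrite ltr_wpDl // addr_ge0 ?rnorm_ge0.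
have d0 : 0 < e / m by rewrite divr_gt0.
have [N1 N1P] := riesz_iter_cvg0 A'l A's A'p f d0.
have [N2 N2P] := riesz_iter_cvg0 A'l A's A'p (S' f) d0.
exists (maxn N1 N2) => n; rewrite geq_max => /andP[/N1P n1 /N2P n2].
have := boundary_pair_form (boundary_pair_riesz n A'l AB') S'f S'y y0.
rewrite f0 y1 => ->; apply: le_lt_trans (ler_rnormB _ _) _.
have := rnorm_inner (riesz_iter A' n f) (S' y).
have := rnorm_inner (riesz_iter A' n (S' f)) y.
have eE : e / m * m = e by rewrite divfK // gt_eqF.
move: n1 n2 d0 eE (rnorm_ge0 y) (rnorm_ge0 (S' y)); rewrite /m.
set p := rnorm (riesz_iter _ _ _); set q := rnorm (riesz_iter _ _ (S' f)).
set s := rnorm y; set t := rnorm (S' y); set d := e / _.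
set v := rnorm (inner _ _); set w := rnorm (inner _ _) => pd qd d0 dE s0 t0 vq wp.
have h1 : q * s <= d * s by rewrite ler_wpM2r // ltW.
have h2 : p * t <= d * t by rewrite ler_wpM2r // ltW.
by rewrite -dE !mulrDr mulr1; lra.
Qed.

Lemma boundary_pair_gamma A B mu h : linear A -> boundary_pair A B ->
  A (gam mu h) = gam mu (B h).
Proof.
move=> Al [AS AB]; have [mu_r|mu_nr] := boolP (mu \is Num.real).
  by rewrite !gamma_real // (lin0 Al).
have [S'g gE g0] := gammaP S_dense S_symmetric G_triplet h mu_nr.
have [S'Ag AgE] := AS _ S'g.
rewrite -{2}g0 (AB _ S'g).1 (gamma_eigen S_dense S_symmetric G_triplet) //.
by split=> //; rewrite AgE gE (linZ Al).
Qed.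

Lemma boundary_pair_weyl A B M mu h : linear A -> boundary_pair A B ->
  weyl_function S G0 G1 M -> mu \isn't Num.real -> B (M mu h) = M mu (B h).
Proof.
move=> Al AB M_weyl mu_nr.
rewrite -!(weyl_gamma S_dense S_symmetric G_triplet M_weyl) //.
rewrite -(boundary_pair_gamma mu h Al AB).
have [S'g _ _] := gammaP S_dense S_symmetric G_triplet h mu_nr.
by rewrite (AB.2 _ S'g).2.
Qed.

Lemma boundary_pair_id A B : boundary_pair A B -> A \o A = id -> B \o B = id.
Proof.
move=> AB AA; apply/funext => h; have [f [S'f <- _]] := triplet_surj G_triplet h 0.
by have [/= -> _] := (boundary_pair_comp AB AB).2 f S'f; have /= -> := congr1 (@^~ f) AA.
Qed.

(** Self-adjointness of [J] and [J C] makes [J C J] the adjoint of [C]. It commutes with [S], so [C]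
    commutes with [S^*]. *)
Lemma C_symmetry_boundary_pair J C B : fundamental_symmetry J ->
    commutes_with S J -> C_symmetry S J C -> boundary_image S G0 G1 C B ->
  boundary_pair C B.
Proof.
move=> [_ Js JJ] [SJ JE] [_ _ [JCs _] [SC CE]] CB; split=> //.
apply: (@adjoint_commutes _ _ _ S_dense C (J \o C \o J)).
  move=> x y; rewrite /= -JCs /= Js; congr (⟪_, _⟫).
  by have /= -> := congr1 (@^~ y) JJ.
move=> x Sx; have SJx := (SJ x).2 Sx; have SCJx := (SC _).2 SJx.
by split; [exact: (SJ _).2|rewrite /= JE // CE // JE].
Qed.

End BoundaryPairs.

(** * Lifting operators from the boundary space *)

(** If the ratio [r] of [a 1] to [a 0] exceeded [b], log-convexity would give [a n >= r^n a 0] for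
    all [n], against [a n <= k b^n] because [(b / r)^n] tends to 0. *)
Lemma log_convex_bound (R : realType) (a : nat -> R) (b k : R) : 0 < b ->
    (forall n, 0 <= a n) -> (forall n, a n.+1 ^+ 2 <= a n * a n.+2) ->
    (forall n, a n <= k * b ^+ n) ->
  a 1%N <= b * a 0%N.
Proof.
move=> b0 a0 aa ak; rewrite leNgt; apply/negP => h.
have a00 : 0 < a 0%N.
  rewrite lt_neqAle a0 andbT; apply/negP => /eqP e0.
  move: h; rewrite -e0 mulr0 => a1; have := aa 0%N; rewrite -e0 mul0r.
  by rewrite leNgt exprn_gt0.
have [r rE] : exists r, r * a 0%N = a 1%N.
  by exists (a 1%N / a 0%N); rewrite divfK ?gt_eqF.
have br : b < r by rewrite -(ltr_pM2r a00) rE.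
have r0 : 0 < r := lt_trans b0 br.
have step n : 0 < a n /\ r * a n <= a n.+1.
  elim: n => [|n [an ran]]; first by rewrite rE.
  have an1 : 0 < a n.+1 by apply: lt_le_trans ran; rewrite mulr_gt0.
  split=> //; rewrite -(ler_pM2l an); apply: le_trans (aa n).
  by rewrite mulrA [a n * r]mulrC expr2 ler_wpM2r.
have geo n : r ^+ n * a 0%N <= a n.
  elim: n => [|n IH]; first by rewrite mul1r.
  by rewrite exprS -mulrA (le_trans _ (step n).2) // ler_pM2l.
pose z := b / r; have z0 : 0 <= z by rewrite divr_ge0 // ltW.
have z1 : `|z| < 1 by rewrite ger0_norm // ltr_pdivrMr // mul1r.
have k0 : 0 < `|k| + 1 by rewrite ltr_wpDl.
have e0 : 0 < a 0%N / (`|k| + 1) by rewrite divr_gt0.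
have /cvgr0Pnorm_lt /(_ _ e0)[N _ /(_ N (leqnn N)) /=] := cvg_expr z1.
rewrite ger0_norm ?exprn_ge0 // ltr_pdivlMr // ltNge => /negP; apply.
have rN : 0 < r ^+ N by rewrite exprn_gt0.
rewrite -(ler_pM2l rN) (le_trans (geo N)) // (le_trans (ak N)) //.
rewrite (mulrA (r ^+ N)) /z expr_div_n (mulrC (r ^+ N)) divfK ?gt_eqF // mulrC.
by rewrite ler_wpM2l ?exprn_ge0 ?(ltW b0) // (le_trans (ler_norm k)) // lerDl.
Qed.

Section DenseForms.
Variables (R : realType) (H : hilbertType R) (P : set H).
Hypothesis P_dense : forall x (e : R), 0 < e -> exists2 y, P y & rnorm (x - y) < e.
Variables (A : H -> H) (b : R).
Hypotheses (A_lin : linear A) (b_ge0 : 0 <= b).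
Hypothesis A_bound : forall x, rnorm (A x) <= b * rnorm x.

Let adj_dense y : (forall x, P x -> ⟪A y, x⟫ = ⟪y, A x⟫) ->
  forall x, ⟪A y, x⟫ = ⟪y, A x⟫.
Proof.
move=> yP x; apply: inner_graph_approx => e e0.
have b0 : 0 < b + 1 by rewrite ltr_wpDl.
have d0 : 0 < e / (b + 1) by rewrite divr_gt0.
have [x' Px' xx'] := P_dense x d0; exists x', (A x'); split; first exact: yP.
  apply: lt_le_trans xx' _; rewrite ler_pdivrMr // ler_peMr ?lerDr //.
  exact: ltW.
rewrite -(linB A_lin); apply: le_lt_trans (A_bound _) _.
apply: (@le_lt_trans _ _ ((b + 1) * rnorm (x - x'))).
  by rewrite ler_wpM2r ?rnorm_ge0 // lerDl.
by rewrite mulrC -ltr_pdivlMr.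
Qed.

Lemma self_adjoint_dense :
  (forall x y, P x -> P y -> ⟪A x, y⟫ = ⟪x, A y⟫) -> self_adjoint A.
Proof.
move=> AP; have AP1 x y : P x -> ⟪A x, y⟫ = ⟪x, A y⟫.
  by move=> Px; apply: adj_dense => x' Px'; exact: AP.
move=> y x; apply: adj_dense => x' Px'.
by rewrite innerC -AP1 // -innerC.
Qed.

Lemma Re_inner_ge0_dense :
  (forall x, P x -> 0 <= Re ⟪A x, x⟫) -> forall x, 0 <= Re ⟪A x, x⟫.
Proof.
move=> AP x; apply: ler_eps => e e0.
pose m := b * (2 * rnorm x + 1) + 1.
have r0 := rnorm_ge0 x.
have m0 : 0 < m by rewrite ltr_wpDl // mulr_ge0 // addr_ge0 // mulr_ge0.
pose d := Num.min 1 (e / m); have d0 : 0 < d by rewrite lt_min ltr01 divr_gt0.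
have [x' Px'] := P_dense x d0; rewrite lt_min ltr_pdivlMr // => /andP[x1 xe].
have := AP x' Px'.
have -> : ⟪A x', x'⟫ = ⟪A x, x⟫ - ⟪A (x - x'), x'⟫ - ⟪A x, x - x'⟫.
  by rewrite (linB A_lin) innerBl innerBr; ring.
rewrite !raddfB /=.
have := lerN_Re_rnorm ⟪A (x - x'), x'⟫; have := lerN_Re_rnorm ⟪A x, x - x'⟫.
have := rnorm_inner (A (x - x')) x'; have := rnorm_inner (A x) (x - x').
have x'r : rnorm x' <= rnorm x + 1.
  have := ler_rnormB x (x - x'); rewrite subKr => /le_trans; apply.
  by rewrite lerD2l ltW.
have h1 : rnorm (A (x - x')) * rnorm x' <= b * rnorm (x - x') * (rnorm x + 1).
  by rewrite ler_pM ?rnorm_ge0.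
have h2 : rnorm (A x) * rnorm (x - x') <= b * rnorm x * rnorm (x - x').
  by rewrite ler_wpM2r ?rnorm_ge0.
have := rnorm_ge0 (x - x'); move: h1 h2 xe; rewrite /m.
set u := rnorm (A _) * rnorm x'; set v := rnorm (A x) * _.
set p := rnorm (inner _ _); set q := rnorm (inner _ _); set c := rnorm (x - x').
by set s := Re _; set t := Re _; set w := Re _; nra.
Qed.

End DenseForms.

Section Lift.
Variables (R : realType) (H K : hilbertType R) (S : operator H).
Variables (G0 G1 : H -> K) (M : R[i] -> K -> K).
Hypotheses (S_dense : densely_defined S) (S_symmetric : symmetric_op S).
Hypothesis G_triplet : boundary_triplet S G0 G1.
Hypothesis M_weyl : weyl_function S G0 G1 M.
Hypothesis S_simple : simple_op S.

Local Notation S' := (adjoint S).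
Local Notation gam := (gamma_field S G0).

Let S'0 : dom S' 0. Proof. by case: (adjoint_linear S_dense). Qed.
Let S'dom a x y : dom S' x -> dom S' y -> dom S' (a *: x + y).
Proof. by case: (adjoint_linear S_dense) => _ + _; exact. Qed.
Let S'lin : linear_on (dom S') S'.
Proof. by case: (adjoint_linear S_dense). Qed.
Let G0lin := triplet_lin0 G_triplet.
Let G1lin := triplet_lin1 G_triplet.
Let gP := gammaP S_dense S_symmetric G_triplet.
Let gam_lin := gamma_linear S_dense S_symmetric G_triplet.

(** Vectors of the span are represented by lists of pairs [(mu, h)], so [B] can act on the
    parameters before the resulting map on vectors is known to be well defined. *)
Definition gamma_sum (B : K -> K) (s : seq (R[i] * K)) : H :=
  \sum_(p <- s) gam p.1 (B p.2).

Lemma gamma_sum_cons B p s : gamma_sum B (p :: s) = gam p.1 (B p.2) + gamma_sum B s.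
Proof. exact: big_cons. Qed.

Lemma gamma_sum_cat B s s' : gamma_sum B (s ++ s') = gamma_sum B s + gamma_sum B s'.
Proof. exact: big_cat. Qed.

Lemma gamma_sum_scale B a s : linear B ->
  gamma_sum B [seq (p.1, a *: p.2) | p <- s] = a *: gamma_sum B s.
Proof.
move=> Bl; rewrite /gamma_sum big_map scaler_sumr; apply: eq_bigr => p _ /=.
by rewrite (linZ Bl) (linZ (gam_lin _)).
Qed.

Lemma gamma_sum_dense x (e : R) : 0 < e ->
  exists s, rnorm (x - gamma_sum id s) < e.
Proof.
move=> e0; have : closed_span (\bigcup_(mu in [set mu | mu \isn't Num.real])
    eigenspace_op S' mu) x by rewrite S_simple.
move=> /closure_rnorm /(_ e e0)[y [n [a [v [vP ->]]]] xy].
suff [s sE] : exists s, gamma_sum id s = \sum_(i < n) a i *: v i.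
  by exists s; rewrite sE.
elim/big_ind: _ => [|u w [s <-] [s' <-]|i _].
- by exists [::]; rewrite /gamma_sum big_nil.
- by exists (s ++ s'); rewrite gamma_sum_cat.
have [mu mu_nr vi] := vP i; exists [:: (mu, a i *: G0 (v i))].
rewrite /gamma_sum big_seq1 /= (linZ (gam_lin _)).
by rewrite (gamma_eigen S_dense S_symmetric G_triplet).
Qed.

(** [lift_core] divides by [mu - nu], so terms with parameter [mu] must be moved away; continuity of
    the gamma field makes the change small. *)
Lemma gamma_sum_dense_avoiding mu x (e : R) : 0 < e ->
  exists2 s, all (fun p => p.1 != mu) s & rnorm (x - gamma_sum id s) < e.
Proof.
move=> e0; have e20 : 0 < e / 2 by rewrite divr_gt0.
have [s xs] := gamma_sum_dense x e20.
suff [s' s'mu ss'] : exists2 s', all (fun p => p.1 != mu) s' &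
    rnorm (gamma_sum id s - gamma_sum id s') < e / 2.
  exists s' => //; rewrite -[x](subrK (gamma_sum id s)) -addrA.
  by rewrite (le_lt_trans (ler_rnormD _ _)) // [ltRHS]splitr ltrD.
elim: s {x xs} (e / 2) e20 => [|[nu h] s IH] {}e {}e0.
  by exists [::]; rewrite // subrr rnorm0.
have e20 : 0 < e / 2 by rewrite divr_gt0.
have [s' s'mu ss'] := IH _ e20.
suff [nu' nu'mu gnu] : exists2 nu', nu' != mu & rnorm (gam nu h - gam nu' h) < e / 2.
  exists ((nu', h) :: s'); first by rewrite /= nu'mu.
  rewrite !gamma_sum_cons /= opprD addrACA.
  by rewrite (le_lt_trans (ler_rnormD _ _)) // [ltRHS]splitr ltrD.
have [<-|nu_mu] := eqVneq nu mu; last by exists nu => //; rewrite subrr rnorm0.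
have [nu_r|nu_nr] := boolP (nu \is Num.real).
  exists (nu + 1); first by rewrite -subr_eq0 addrC addKr oner_eq0.
  by rewrite !gamma_real ?subrr ?rnorm0 // rpredD ?rpred1.
have [d d0 dP] := gamma_approx S_dense S_symmetric G_triplet h nu_nr e20.
have d20 : 0 < d / 2 by rewrite divr_gt0.
exists (nu + (d / 2)%:C).
  rewrite -subr_eq0 addrC addKr; apply/eqP => /(congr1 Re) /=.
  by move/eqP; rewrite gt_eqF.
rewrite rnormB; apply: dP.
  by move: nu_nr; rewrite !nonreal_Im raddfD /= addr0.
by rewrite addrC addKr rnorm_real ?(ltW d20) //; lra.
Qed.

Variables (B : K -> K) (b : R).
Hypotheses (B_lin : linear B) (B_sa : self_adjoint B) (b_ge0 : 0 <= b).
Hypothesis B_bound : forall h, rnorm (B h) <= b * rnorm h.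
Hypothesis B_weyl : forall mu h, mu \isn't Num.real -> B (M mu h) = M mu (B h).

(* The case mu = conj nu is obtained by moving nu horizontally. *)
Lemma gamma_form_sym mu nu h g :
  ⟪gam mu (B h), gam nu g⟫ = ⟪gam mu h, gam nu (B g)⟫.
Proof.
have [mu_r|mu_nr] := boolP (mu \is Num.real).
  by rewrite !(gamma_real _ _ _ mu_r) !inner0l.
(* Here the factor [mu - conjc nu'] in [gamma_inner] can be cancelled, and the right sides agree
   because [B] is self-adjoint and commutes with [M]. *)
have offdiag nu' : nu' \isn't Num.real -> mu != conjc nu' ->
    ⟪gam mu (B h), gam nu' g⟫ = ⟪gam mu h, gam nu' (B g)⟫.
  move=> nu_nr mu_nu; have mn : mu - conjc nu' != 0 by rewrite subr_eq0.
  apply: (mulfI mn).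
  rewrite !(gamma_inner S_dense S_symmetric G_triplet M_weyl) //.
  by rewrite -!B_weyl // !B_sa.
have [nu_r|nu_nr] := boolP (nu \is Num.real).
  by rewrite !(gamma_real _ _ _ nu_r) // !inner0r.
have [mu_nu|] := eqVneq mu (conjc nu); last exact: offdiag.
apply: inner_graph_approx => e e0.
have [d1 d10 d1P] := gamma_approx S_dense S_symmetric G_triplet g nu_nr e0.
have [d2 d20 d2P] := gamma_approx S_dense S_symmetric G_triplet (B g) nu_nr e0.
pose t := Num.min d1 d2 / 2.
have m0 : 0 < Num.min d1 d2 by rewrite lt_min d10.
have t0 : 0 < t by rewrite divr_gt0.
have tm : t < Num.min d1 d2 by rewrite /t; move: m0; set m := Num.min _ _; lra.
pose nu' := nu + t%:C.
have nu'_nr : nu' \isn't Num.real by move: nu_nr; rewrite !nonreal_Im raddfD /= addr0.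
have nu'E : rnorm (nu' - nu) = t by rewrite addrC addKr rnorm_real // ltW.
move: tm; rewrite lt_min => /andP[t1 t2].
exists (gam nu' g), (gam nu' (B g)); split.
- apply: offdiag => //; rewrite mu_nu; apply/eqP => /(congr1 conjc).
  rewrite !conjcK => /eqP; rewrite -subr_eq0 opprD addNKr oppr_eq0.
  move=> /eqP /(congr1 Re) /= tE.
  by move: t0; rewrite tE ltxx.
- by rewrite rnormB; apply: d1P => //; rewrite nu'E.
- by rewrite rnormB; apply: d2P => //; rewrite nu'E.
Qed.

(** [vec n s] stands for [A^n x] with [x = vec 0 s], before [A] exists. *)
Let vec n s := gamma_sum (iter n B) s.

Let vec_sym n m s s' : ⟪vec n.+1 s, vec m s'⟫ = ⟪vec n s, vec m.+1 s'⟫.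
Proof.
rewrite /vec; elim: s => [|p s IH]; first by rewrite /gamma_sum !big_nil !inner0l.
rewrite !gamma_sum_cons !innerDl {}IH; congr (_ + _).
elim: s' => [|q s' IH]; first by rewrite /gamma_sum !big_nil !inner0r.
by rewrite !gamma_sum_cons !innerDr {}IH !iterS gamma_form_sym.
Qed.

Let iter_lin n : linear (iter n B).
Proof. by elim: n => [//|n IH] a x y; rewrite !iterS IH B_lin. Qed.

Let iter_bound n h : rnorm (iter n B h) <= b ^+ n * rnorm h.
Proof.
elim: n => [|n IH]; first by rewrite mul1r.
by rewrite iterS exprS -mulrA (le_trans (B_bound _)) // ler_wpM2l.
Qed.

Let vec_bound s : exists k, forall n, rnorm (vec n s) <= k * b ^+ n.
Proof.
elim: s => [|[mu h] s [k kP]].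
  by exists 0 => n; rewrite /vec /gamma_sum big_nil rnorm0 mul0r.
have [c c0 cP] := gamma_bounded S_dense S_symmetric G_triplet M_weyl mu.
exists (c * rnorm h + k) => n; rewrite /vec gamma_sum_cons mulrDl.
apply: le_trans (ler_rnormD _ _) (lerD _ (kP n)); apply: le_trans (cP _) _.
by rewrite -mulrA ler_wpM2l // mulrC iter_bound.
Qed.

(** [|vec (n+1) s|^2 = (vec n s, vec (n+2) s)] by symmetry, so the norms are log-convex; they grow
    at most like [b^n]. The base [b + 1] is used because [log_convex_bound] needs it strictly
    positive. *)
Let vec_contr s : rnorm (vec 1 s) <= (b + 1) * rnorm (vec 0 s).
Proof.
have [k kP] := vec_bound s.
apply: (@log_convex_bound _ (fun n => rnorm (vec n s)) (b + 1) `|k|).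
- by rewrite ltr_wpDl.
- by move=> n; exact: rnorm_ge0.
- by move=> n; rewrite -Re_inner_rnorm vec_sym Re_innerM.
- move=> n; rewrite (le_trans (kP n)) //.
  rewrite (le_trans (ler_wpM2r _ (ler_norm k))) ?exprn_ge0 //.
  by rewrite ler_wpM2l // lerXn2r ?nnegrE ?addr_ge0 // lerDl.
Qed.

Lemma gamma_lift_exists : exists A : H -> H,
  [/\ linear A, exists2 c : R, 0 <= c & forall x, rnorm (A x) <= c * rnorm x,
      self_adjoint A & forall mu h, A (gam mu h) = gam mu (B h)].
Proof.
pose G x y := exists s, x = vec 0 s /\ y = vec 1 s.
have b10 : 0 <= b + 1 by rewrite addr_ge0.
have [|||A [Al Ab AG]] := @extend_bounded R H H G (b + 1) b10.
- move=> a _ _ _ _ [s [-> ->]] [s' [-> ->]].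
  exists ([seq (p.1, a *: p.2) | p <- s] ++ s').
  by rewrite /vec !gamma_sum_cat !(gamma_sum_scale _ _ (iter_lin _)).
- by move=> _ _ [s [-> ->]]; exact: vec_contr.
- move=> x e e0; have [s sx] := gamma_sum_dense x e0.
  by exists (vec 0 s) => //; exists (vec 1 s), s.
have As s : A (vec 0 s) = vec 1 s by apply: AG; exists s.
exists A; split=> //; first by exists (b + 1).
  apply: (@self_adjoint_dense _ _ (range (vec 0)) _ A (b + 1)) => //.
    move=> x e e0; have [s sx] := gamma_sum_dense x e0.
    by exists (vec 0 s) => //; exists s.
  by move=> _ _ [s _ <-] [s' _ <-]; rewrite !As vec_sym.
move=> mu h; have := As [:: (mu, h)].
by rewrite /vec /gamma_sum !big_seq1.
Qed.

Variables (A : H -> H) (c : R).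
Hypotheses (A_lin : linear A) (A_sa : self_adjoint A) (c_ge0 : 0 <= c).
Hypothesis A_bound : forall x, rnorm (A x) <= c * rnorm x.
Hypothesis A_gam : forall mu h, A (gam mu h) = gam mu (B h).

(* The differences gam mu h - gam nu h span a core of S^* restricted to
   ker G0 on which A commutes with it. *)
Lemma lift_core mu s : mu \isn't Num.real -> all (fun p => p.1 != mu) s ->
  exists u, [/\ dom S' u, G0 u = 0, S' u - mu *: u = gamma_sum id s,
    dom S' (A u) & G0 (A u) = 0 /\ S' (A u) = A (S' u)].
Proof.
move=> mu_nr; elim: s => [_|[nu h] s IH /= /andP[nu_mu /IH]].
  have S'z : S' 0 = 0 := linear_on0 S'0 S'lin.
  have G0z : G0 0 = 0 := linear_on0 S'0 G0lin.
  by exists 0; rewrite /gamma_sum big_nil (lin0 A_lin) S'z scaler0 subrr (lin0 A_lin).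
move=> [u [S'u u0 uE S'Au [Au0 AuE]]].
have [nu_r|nu_nr] := boolP (nu \is Num.real).
  by exists u; rewrite gamma_sum_cons /= gamma_real // add0r.
have [S'v v0 vE] := gamma_resolvent S_dense S_symmetric G_triplet h mu_nr nu_nr.
have [S'w w0 _] := gamma_resolvent S_dense S_symmetric G_triplet (B h) mu_nr nu_nr.
set v := gam mu h - gam nu h in S'v v0 vE.
have Av : A v = gam mu (B h) - gam nu (B h) by rewrite (linB A_lin) !A_gam.
have AvE : S' (A v) = A (S' v).
  have [[S'm mE _] [S'n nE _]] := (gP h mu_nr, gP h nu_nr).
  have [[S'm' mE' _] [S'n' nE' _]] := (gP (B h) mu_nr, gP (B h) nu_nr).
  rewrite Av !(linear_onB S'lin) // mE nE mE' nE'.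
  by rewrite (linB A_lin) !(linZ A_lin) !A_gam.
have S'Av : dom S' (A v) by rewrite Av.
(* By [gamma_resolvent], [a *: v] solves [(S^* - mu) x = gam nu h], the new term of the sum. *)
pose a := (mu - nu)^-1; pose w := a *: v + u.
have AwE : A w = a *: A v + A u by rewrite A_lin.
have S'wE : S' w = a *: S' v + S' u by rewrite S'lin.
have S'w1 : dom S' w by exact: S'dom.
have w10 : G0 w = 0 by rewrite G0lin // v0 u0 scaler0 addr0.
have S'Aw : dom S' (A w) by rewrite AwE; exact: S'dom.
have Aw0 : G0 (A w) = 0 by rewrite AwE G0lin // Av w0 Au0 scaler0 addr0.
have S'AwE : S' (A w) = A (S' w) by rewrite AwE S'lin // S'wE A_lin AvE AuE.
have wE : S' w - mu *: w = gamma_sum id ((nu, h) :: s).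
  rewrite S'wE gamma_sum_cons scalerDr opprD addrACA uE; congr (_ + _).
  rewrite scalerA mulrC -scalerA -scalerBr vE scalerA mulVf ?scale1r //.
  by rewrite subr_eq0 eq_sym.
by exists w; split.
Qed.

(** By self-adjointness on [ker G0] it is enough to prove [⟪S^* v, A u⟫ = ⟪v, A (S^* u)⟫] for [v] in
    [ker G0]. This holds on the core, and [u] is approximated from it in the graph norm. *)
Lemma lift_ker0 u : dom S' u -> G0 u = 0 ->
  [/\ dom S' (A u), S' (A u) = A (S' u) & G0 (A u) = 0].
Proof.
move=> S'u u0; pose mu : R[i] := 'i%C.
have mu_nr : mu \isn't Num.real by rewrite nonreal_Im /= oner_eq0.
apply: (triplet_ker0_selfadjoint S_dense S_symmetric G_triplet) => v S'v v0.
apply: inner_graph_approx => e e0.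
(* At [mu = i] the lower bound has constant 1, so an error [d] on [(S^* - mu) u] costs at most [d]
   on [u] and [2 d] on [S^* u], and [A] multiplies these by at most [c]. *)
pose d := e / (c * 2 + 1); have c1 : 0 < c * 2 + 1 by rewrite ltr_wpDl // mulr_ge0.
have d0 : 0 < d by rewrite divr_gt0.
have dE : d * (c * 2 + 1) = e by rewrite divfK // gt_eqF.
have [s smu us] := gamma_sum_dense_avoiding mu (S' u - mu *: u) d0.
have [w [S'w w0 wE S'Aw [Aw0 AwE]]] := lift_core mu_nr smu.
have S'uw : dom S' (u - w) by exact: subspaceB.
have uwE : S' u - mu *: u - (S' w - mu *: w) = S' u - S' w - mu *: (u - w).
  by rewrite scalerBr !opprD !opprK addrACA.
have uw : rnorm (u - w) < d.
  apply: le_lt_trans us; rewrite -wE.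
  have := triplet_ker0_lower G_triplet mu S'uw.
  rewrite (linear_onB G0lin) // u0 w0 subrr => /(_ erefl).
  rewrite normr1 mul1r => /le_trans; apply.
  by rewrite (linear_onB S'lin) // uwE.
have Suw : rnorm (S' u - S' w) < d * 2.
  have -> : S' u - S' w = (S' u - mu *: u - gamma_sum id s) + mu *: (u - w).
    by rewrite -wE uwE subrK.
  apply: le_lt_trans (ler_rnormD _ _) _; rewrite rnormZ.
  have -> : rnorm mu = 1 by rewrite /rnorm normc_def /= expr0n expr1n add0r sqrtr1.
  by rewrite mul1r mulr_natr mulr2n ltrD.
exists (A w), (A (S' w)); split.
- rewrite -AwE; apply/eqP.
  by rewrite -subr_eq0 (triplet_green G_triplet) // v0 Aw0 inner0l inner0r subrr.
- rewrite -(linB A_lin) (le_lt_trans (A_bound _)) // -dE.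
  move: uw d0; set t := rnorm _ => td d0.
  have : c * t <= c * d by rewrite ler_wpM2l // ltW.
  have : 0 <= c * d by rewrite mulr_ge0 // ltW.
  lra.
- rewrite -(linB A_lin) (le_lt_trans (A_bound _)) // -dE.
  move: Suw d0; set t := rnorm _ => td d0.
  have : c * t <= c * (d * 2) by rewrite ler_wpM2l // ltW.
  have : 0 <= c * d by rewrite mulr_ge0 // ltW.
  lra.
Qed.

Lemma lift_boundary_pair : boundary_pair S G0 G1 A B.
Proof.
pose mu : R[i] := 'i%C.
have mu_nr : mu \isn't Num.real by rewrite nonreal_Im /= oner_eq0.
(* Each [x] in [dom S^*] splits into a vector of [ker G0], handled by [lift_ker0], and a vector of
   [ker (S^* - i)], handled by [A_gam]. *)
have key x : dom S' x -> [/\ dom S' (A x), S' (A x) = A (S' x) & G0 (A x) = B (G0 x)].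
  move=> S'x; have [S'g gE g0] := gP (G0 x) mu_nr.
  have [S'Bg BgE Bg0] := gP (B (G0 x)) mu_nr.
  have S'u : dom S' (x - gam mu (G0 x)) by exact: subspaceB.
  have u0 : G0 (x - gam mu (G0 x)) = 0 by rewrite (linear_onB G0lin) // g0 subrr.
  have [S'Au AuE Au0] := lift_ker0 S'u u0.
  have xE : x = x - gam mu (G0 x) + gam mu (G0 x) by rewrite subrK.
  have AxE : A x = A (x - gam mu (G0 x)) + gam mu (B (G0 x)).
    by rewrite {1}xE (linD A_lin) A_gam.
  split; rewrite AxE; first exact: subspaceD.
    rewrite (linear_onD S'lin) // AuE BgE -A_gam -(linZ A_lin) -gE -(linD A_lin).
    by rewrite -(linear_onD S'lin) // subrK.
  by rewrite (linear_onD G0lin) // Au0 Bg0 add0r.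
split=> x S'x; have [S'Ax AxE Ax0] := key x S'x => //.
(* For [G1], Green's identities at [(A x, gam mu g)] and [(x, A (gam mu g))] have equal left sides.
   The terms in [G0 x] coincide since [B] commutes with [M mu], which leaves the identity tested
   against [g]. *)
split=> //; apply: inner_inj => g; rewrite innerC [RHS]innerC; congr conjc.
have [S'g gE g0] := gP g mu_nr.
have [S'Ag AgE Ag0] := key _ S'g.
have := triplet_green G_triplet S'x S'Ag.
rewrite AgE -!A_sa -AxE (triplet_green G_triplet) // Ax0 Ag0 g0 A_gam.
rewrite !(weyl_gamma S_dense S_symmetric G_triplet M_weyl) // -B_weyl // -B_sa.
by rewrite -(B_sa (G0 x)) => /addIr ->.
Qed.

(** On the span, the iterates of [A] act through those of [B] on the parameters. They tend strongly
    to 0 because each [gam mu] is bounded, so [riesz_iter_lower] gives the bound there. *)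
Lemma lift_lower : (forall h, 0 <= Re ⟪B h, h⟫) ->
  exists2 k : R, 0 < k & forall x, rnorm (A x) ^+ 2 <= k * Re ⟪A x, x⟫.
Proof.
move=> B_ge0; pose k := b + 1; have k0 : 0 < k by rewrite ltr_wpDl.
have Bk h : rnorm (B h) <= k * rnorm h.
  by rewrite (le_trans (B_bound h)) // ler_wpM2r ?rnorm_ge0 // lerDl.
set A' := rescale k A; set B' := rescale k B.
have A'l : linear A' := rescale_linear k A_lin.
have A's : self_adjoint A' := rescale_self_adjoint k A_sa.
have B'l : linear B' := rescale_linear k B_lin.
have B's : self_adjoint B' := rescale_self_adjoint k B_sa.
have B'p := rescale_bounds k0 Bk B_ge0.
have A'gam n mu h : riesz_iter A' n (gam mu h) = gam mu (riesz_iter B' n h).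
  elim: n h => [|n IH] h /=; last by rewrite !IH (linB (gam_lin _)).
  by rewrite /A' /rescale A_gam (linZ (gam_lin _)).
have A'sum n s : riesz_iter A' n (gamma_sum id s) = gamma_sum (riesz_iter B' n) s.
  elim: s => [|p s IH].
    by rewrite /gamma_sum !big_nil (lin0 (riesz_iter_linear n A'l)).
  by rewrite !gamma_sum_cons (linD (riesz_iter_linear n A'l)) A'gam IH.
have sum_cvg0 s (e : R) : 0 < e -> exists N, forall n, (N <= n)%N ->
    rnorm (gamma_sum (riesz_iter B' n) s) < e.
  elim: s e => [|[mu h] s IH] e e0.
    by exists 0%N => n _; rewrite /gamma_sum big_nil rnorm0.
  have e20 : 0 < e / 2 by rewrite divr_gt0.
  have [N1 N1P] := IH _ e20.
  have [q q0 qP] := gamma_bounded S_dense S_symmetric G_triplet M_weyl mu.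
  have q1 : 0 < q + 1 by rewrite ltr_wpDl.
  have d0 : 0 < e / 2 / (q + 1) by rewrite divr_gt0.
  have [N2 N2P] := riesz_iter_cvg0 B'l B's B'p h d0.
  exists (maxn N1 N2) => n; rewrite geq_max => /andP[/N1P n1 /N2P n2].
  rewrite gamma_sum_cons [ltRHS]splitr; apply: le_lt_trans (ler_rnormD _ _) (ltrD _ n1).
  apply: le_lt_trans (qP _) _; move: n2; rewrite ltr_pdivlMr //; apply: le_lt_trans.
  by rewrite mulrC ler_wpM2l ?rnorm_ge0 // lerDl.
have span_lower s : rnorm (A (gamma_sum id s)) ^+ 2 <=
    k * Re ⟪A (gamma_sum id s), gamma_sum id s⟫.
  apply: rescale_lower => //; apply: riesz_iter_lower => // e e0.
  have r1 : 0 < rnorm (gamma_sum id s) + 1 by rewrite ltr_wpDl // rnorm_ge0.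
  have [N NP] := sum_cvg0 s _ (divr_gt0 e0 r1).
  exists N => n /NP; rewrite -A'sum ltr_pdivlMr //; apply: le_lt_trans.
  by rewrite (le_trans (rnorm_inner _ _)) // ler_wpM2l ?rnorm_ge0 // lerDl.
(* The bound says that the form of [E = k A - A^2] is nonnegative; as [E] is linear and bounded,
   this extends from the dense span. *)
exists k => // x; pose E y := k%:C *: A y - A (A y).
have EE y : Re ⟪E y, y⟫ = k * Re ⟪A y, y⟫ - rnorm (A y) ^+ 2.
  by rewrite innerBl raddfB /= Re_inner_real (A_sa (A y)) Re_inner_rnorm.
have E_lin : linear E.
  move=> a u v; rewrite /E !A_lin scalerDr scalerBr !scalerA (mulrC a).
  by rewrite opprD addrACA.
have E_bound y : rnorm (E y) <= (k * c + c * c) * rnorm y.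
  rewrite (le_trans (ler_rnormB _ _)) // mulrDl lerD //.
    by rewrite rnormZ rnorm_real ?(ltW k0) // -mulrA ler_wpM2l // ltW.
  by rewrite (le_trans (A_bound _)) // -mulrA ler_wpM2l.
rewrite -subr_ge0 -EE.
apply: (@Re_inner_ge0_dense _ _ (range (gamma_sum id)) _ E (k * c + c * c)) => //.
- move=> y e e0; have [s ys] := gamma_sum_dense y e0.
  by exists (gamma_sum id s) => //; exists s.
- by rewrite addr_ge0 ?mulr_ge0 // ltW.
- by move=> _ [s _ <-]; rewrite EE subr_ge0.
Qed.

End Lift.

(** * C-symmetries *)

Section CSymmetries.
Variables (R : realType) (H K : hilbertType R) (S : operator H).
Variables (G0 G1 : H -> K) (M : R[i] -> K -> K) (J : H -> H) (calJ : K -> K).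
Hypotheses (S_dense : densely_defined S) (S_symmetric : symmetric_op S).
Hypothesis G_triplet : boundary_triplet S G0 G1.
Hypothesis M_weyl : weyl_function S G0 G1 M.
Hypotheses (J_fund : fundamental_symmetry J) (S_J : commutes_with S J).
Hypothesis J_image : boundary_image S G0 G1 J calJ.

Local Notation S' := (adjoint S).
Local Notation gam := (gamma_field S G0).

Let J_bounded : bounded_op J. Proof. by case: J_fund. Qed.
Let J_lin : linear J. Proof. by case: J_bounded. Qed.
Let J_sa : self_adjoint J. Proof. by case: J_fund. Qed.
Let JK x : J (J x) = x.
Proof. by case: J_fund => _ _ /(congr1 (@^~ x)). Qed.

Let J_pair : boundary_pair S G0 G1 J calJ.
Proof.
split=> //; apply: (adjoint_commutes S_dense J_sa) => x Sx.
by split; [exact: (S_J.1 x).2|exact: S_J.2].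
Qed.

(** Strict positivity of [calJ T] comes from the lower bound transported from [J C], together with
    injectivity: [calJ] and [T] are both involutions. *)
Lemma C_symmetry_image C T : C_symmetry S J C -> boundary_image S G0 G1 C T ->
  [/\ T \o T = id, positive_op (calJ \o T)
    & forall mu, mu \isn't Num.real -> T \o M mu = M mu \o T].
Proof.
move=> C_sym CT; have [C_bounded CC [JC_sa JC_pos] _] := C_sym.
have C_lin : linear C by case: C_bounded.
have C_pair := C_symmetry_boundary_pair S_dense J_fund S_J C_sym CT.
have JC_pair := boundary_pair_comp J_pair C_pair.
have TT := boundary_pair_id G_triplet C_pair CC.
split=> //; last first.
  move=> mu mu_nr; apply/funext => h /=.
  exact: (boundary_pair_weyl S_dense S_symmetric G_triplet h C_lin C_pair M_weyl mu_nr).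
have JC_bounded : bounded_op (J \o C).
  move/bounded_opP: J_bounded => [_ [c c0 Jc]].
  move/bounded_opP: C_bounded => [_ [d d0 Cd]].
  apply/bounded_opP; split; first by move=> a x y; rewrite /= C_lin J_lin.
  exists (c * d) => [|x]; first exact: mulr_ge0.
  by rewrite (le_trans (Jc _)) // -mulrA ler_wpM2l.
have JC_ge0 x : 0 <= Re ⟪(J \o C) x, x⟫.
  have [->|/JC_pos] := eqVneq x 0; first by rewrite inner0r.
  by rewrite ltcE => /andP[_ /ltW].
have [c c0 Bc] := boundary_pair_lower S_dense G_triplet JC_bounded JC_sa JC_ge0 JC_pair.
apply: (positive_op_lower c0) => //.
  exact: (boundary_pair_self_adjoint G_triplet JC_pair JC_sa).
move=> h /= Bh0; have calJK : calJ \o calJ = id.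
  by apply: (boundary_pair_id G_triplet J_pair); apply/funext => x /=.
have calJ_lin := boundary_pair_linear S_dense G_triplet J_lin J_pair.
have T_lin := boundary_pair_linear S_dense G_triplet C_lin C_pair.
have Th0 : T h = 0.
  by have /= <- := congr1 (@^~ (T h)) calJK; rewrite Bh0 (lin0 calJ_lin).
by have /= <- := congr1 (@^~ h) TT; rewrite Th0 (lin0 T_lin).
Qed.

Hypotheses (S_linear : linear_op S) (S_closed : closed_op S).
Hypothesis S_simple : simple_op S.

Lemma C_symmetry_lift T : bounded_op T -> T \o T = id -> positive_op (calJ \o T) ->
    (forall mu, mu \isn't Num.real -> T \o M mu = M mu \o T) ->
  exists2 C, C_symmetry S J C & boundary_image S G0 G1 C T.
Proof.
move=> /bounded_opP[T_lin [t t0 Tt]] TT [B_sa B_pos] TM.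
have calJ_lin := boundary_pair_linear S_dense G_triplet J_lin J_pair.
have calJ_sa := boundary_pair_self_adjoint G_triplet J_pair J_sa.
have calJK h : calJ (calJ h) = h.
  have JJ : J \o J = id by apply/funext => x /=.
  by have := congr1 (@^~ h) (boundary_pair_id G_triplet J_pair JJ).
have TK h : T (T h) = h by have := congr1 (@^~ h) TT.
set B := calJ \o T in B_sa B_pos.
have B_lin : linear B by move=> a x y; rewrite /B /= T_lin calJ_lin.
(* [calJ] is a self-adjoint involution, hence isometric, so [B] inherits the bound of [T]. *)
have B_bound h : rnorm (B h) <= t * rnorm h.
  have -> : rnorm (B h) = rnorm (T h); last exact: Tt.
  apply/eqP; rewrite -(@eqrXn2 _ 2) ?rnorm_ge0 // -!Re_inner_rnorm.
  by rewrite calJ_sa calJK.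
have B_weyl mu h : mu \isn't Num.real -> B (M mu h) = M mu (B h).
  move=> mu_nr; rewrite /B /=; have /= -> := congr1 (@^~ h) (TM mu mu_nr).
  exact: (boundary_pair_weyl S_dense S_symmetric G_triplet _ J_lin J_pair M_weyl mu_nr).
have B_ge0 h : 0 <= Re ⟪B h, h⟫.
  have [->|/B_pos] := eqVneq h 0; first by rewrite inner0r.
  by rewrite ltcE => /andP[_ /ltW].
have [A [A_lin [c c0 A_bound] A_sa A_gam]] := gamma_lift_exists S_dense S_symmetric
  G_triplet M_weyl S_simple B_lin B_sa t0 B_bound B_weyl.
have A_pair := lift_boundary_pair S_dense S_symmetric G_triplet M_weyl S_simple
  B_sa B_weyl A_lin A_sa c0 A_bound A_gam.
have [k k0 A_lower] := lift_lower S_dense S_symmetric G_triplet M_weyl S_simple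
  B_lin B_sa t0 B_bound A_lin A_sa c0 A_bound A_gam B_ge0.
pose C := J \o A.
have C_lin : linear C by move=> a x y; rewrite /C /= A_lin J_lin.
have C_bounded : bounded_op C.
  move/bounded_opP: J_bounded => [_ [d d0 Jd]].
  apply/bounded_opP; split=> //; exists (d * c) => [|x]; first exact: mulr_ge0.
  by rewrite (le_trans (Jd _)) // -mulrA ler_wpM2l.
have JB : calJ \o B = T by apply/funext => h; rewrite /B /= calJK.
have C_pair : boundary_pair S G0 G1 C T.
  by rewrite -JB; exact: boundary_pair_comp.
(* On defect vectors [C (gam mu g) = gam mu (T g)], so [C^2 = I] follows there from [T^2 = I] and
   extends to the whole space by density. *)
have CK x : C (C x) = x.
  have [d d0 Cd] := ((bounded_opP _).1 C_bounded).2.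
  apply/eqP; rewrite -subr_eq0; apply/eqP.
  pose f y := C (C y) - y; rewrite -/(f x).
  apply: (@dense_eq0 _ _ _ f (d * d + 1) (range (gamma_sum S G0 id))).
  - move=> y z; have -> : f y - f z = f (y - z).
      by rewrite /f !(linB C_lin) !opprD !opprK addrACA.
    rewrite (le_trans (ler_rnormB _ _)) // mulrDl mul1r lerD2r.
    by rewrite (le_trans (Cd _)) // -mulrA ler_wpM2l.
  - move=> y e /(gamma_sum_dense S_dense S_symmetric G_triplet S_simple y)[s ys].
    by exists (gamma_sum S G0 id s) => //; exists s.
  move=> _ [s _ <-]; rewrite /f.
  elim: s => [|p s IH].
    by rewrite /gamma_sum big_nil !(lin0 C_lin) subrr.
  rewrite gamma_sum_cons !(linD C_lin) opprD addrACA IH addr0.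
  have Cg g : C (gam p.1 g) = gam p.1 (T g).
    exact: (boundary_pair_gamma S_dense S_symmetric G_triplet).
  by rewrite !Cg TK subrr.
(* The boundary values of [C x] are the images under [T] of those of [x], hence zero, and
   [triplet_ker_dom] puts [C x] back in [dom S]. *)
have SC x : dom S x -> dom S (C x) /\ S (C x) = C (S x).
  move=> Sx; have [S'x S'xE] := adjoint_extends S_dense S_symmetric Sx.
  have [x0 x1] := triplet_dom S_dense S_symmetric G_triplet Sx.
  have [S'Cx CxE] := C_pair.1 x S'x; have [Cx0 Cx1] := C_pair.2 x S'x.
  have SCx : dom S (C x).
    apply: (triplet_ker_dom S_dense S_symmetric G_triplet) => //.
      by rewrite -Cx0 x0 (lin0 T_lin).
    by rewrite -Cx1 x1 (lin0 T_lin).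
  split=> //; have [_ <-] := adjoint_extends S_dense S_symmetric SCx.
  by rewrite CxE S'xE.
have JCA : J \o C = A by apply/funext => x; rewrite /C /= JK.
exists C; last by case: C_pair.
split=> //; first by apply/funext => x /=.
  rewrite JCA; apply: (positive_op_lower k0) => // x Ax0.
  by rewrite -[x]CK /C /= Ax0 (lin0 J_lin) (lin0 A_lin) (lin0 J_lin).
split=> x; last by case/SC.
by split=> [/SC[]|/SC[]//]; rewrite CK.
Qed.

End CSymmetries.

Theorem theorem3p19 (R : realType) (H : hilbertType R)
    (S : operator H) (J : H -> H)
    (S_linear : linear_op S) (S_closed : closed_op S)
    (S_simple : simple_op S) (S_dense : densely_defined S)
    (S_symmetric : symmetric_op S) (S_defect : equal_defect_numbers S)
    (J_symmetry : nontrivial_fundamental_symmetry J)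
    (S_J : commutes_with S J)
    (D : Type) (C_ : D -> H -> H)
    (C_all : range C_ = [set C | C_symmetry S J C])
    (K : hilbertType R) (G0 G1 : H -> K)
    (G_triplet : boundary_triplet S G0 G1)
    (calC : D -> K -> K)
    (calC_def : forall alpha, boundary_image S G0 G1 (C_ alpha) (calC alpha))
    (j : D) (C_j : C_ j = J)
    (M : R[i] -> K -> K) (M_weyl : weyl_function S G0 G1 M)
    (T : K -> K) (T_bounded : bounded_op T) :
  range calC T <->
  [/\ T \o T = id,
      positive_op (calC j \o T)
    & forall lambda, lambda \isn't Num.real ->
        T \o M lambda = M lambda \o T].
Proof.
have [J_fund _ _] := J_symmetry.
have J_image : boundary_image S G0 G1 J (calC j) by rewrite -C_j; exact: calC_def.
split=> [[alpha _ <-]|[TT B_pos TM]].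
  have C_sym : C_symmetry S J (C_ alpha).
    by have : range C_ (C_ alpha) by [exists alpha]; rewrite C_all.
  exact: (C_symmetry_image S_dense S_symmetric G_triplet M_weyl J_fund S_J J_image C_sym).
have [C C_sym CT] := C_symmetry_lift S_dense S_symmetric G_triplet M_weyl J_fund S_J
  J_image S_linear S_closed S_simple T_bounded TT B_pos TM.
have [alpha _ CE] : range C_ C by rewrite C_all.
(* [T] and [calC alpha] are boundary images of the same [C], and [G0] is onto, so they coincide. *)
exists alpha => //; apply/funext => h.
have [f [S'f <- _]] := triplet_surj G_triplet h 0.
by rewrite (CT f S'f).1 (calC_def alpha f S'f).1 CE.
Qed.
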